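(* Let $N\ge 3$ and $\gamma\in(0,\pi)$, and let $\lambda_1(\gamma)$ be the first Dirichlet eigenvalue of $-\Delta_{S^{N-1}}$ on the spherical cap $\mathcal{D}_\gamma$. Then $$\Big(\frac{\sin\gamma}{\gamma}\Big)^{N-2}\Big(\frac{B_1}{\gamma}\Big)^2\ \le\ \lambda_1(\gamma)\ \le\ \Big(\frac{\gamma}{\sin\gamma}\Big)^{N-2}\Big(\frac{B_1}{\gamma}\Big)^2,$$ where $B_1$ is the first positive zero of the Bessel function $J_{\frac{N-3}{2}}$ of order $(N-3)/2$.
   Context: For $0<\gamma<\pi$, $\mathcal{C}_\gamma=\{x\in\mathbb{R}^N\setminus\{0\} : x_N>|x|\cos\gamma\}$ is the circular cone with vertex $0$, axis the positive $x_N$-axis and slot $\gamma$; $\mathcal{D}_\gamma=\mathcal{C}_\gamma\cap S^{N-1}$; and $\Delta_{S^{N-1}}$ is the Laplace–Beltrami operator on the unit sphere $S^{N-1}$. $J_\nu$ is the Bessel function of the first kind. *)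

(* Defs.v *)
From HB Require Import structures.
From mathcomp Require Import all_boot all_order all_algebra.
From mathcomp Require Import all_classical all_reals all_analysis.

Set Implicit Arguments.
Unset Strict Implicit.
Unset Printing Implicit Defensive.

Import Order.TTheory GRing.Theory Num.Theory.
Import numFieldNormedType.Exports.

Local Open Scope classical_set_scope.
Local Open Scope ring_scope.

Definition is_least (R : realType) (A : set R) (a : R) : Prop :=
  A a /\ lbound A a.

(** * The cone and the spherical cap

    The ambient space R^N is ['rV[R]_n.+1] with N = n.+1; the coordinate x_N is
    [x ord0 ord_max]. *)

(* The library norm [`|x|] on row vectors is the sup norm. *)
Definition enorm (R : realType) (n : nat) (x : 'rV[R]_n.+1) : R :=
  Num.sqrt (\sum_i x ord0 i ^+ 2).

Definition sphere (R : realType) (n : nat) : set 'rV[R]_n.+1 :=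
  [set x | enorm x = 1].
Arguments sphere : clear implicits.

Definition cone (R : realType) (n : nat) (gamma : R) : set 'rV[R]_n.+1 :=
  [set x | x != 0 /\ enorm x * cos gamma < x ord0 ord_max].
Arguments cone {R} n gamma.

Definition cap (R : realType) (n : nat) (gamma : R) : set 'rV[R]_n.+1 :=
  cone n gamma `&` sphere R n.
Arguments cap {R} n gamma.

(* Boundary relative to the sphere: the cap is relatively open in the sphere and
   the sphere is closed, so this is [closure] minus the cap itself. *)
Definition cap_boundary (R : realType) (n : nat) (gamma : R) :
    set 'rV[R]_n.+1 :=
  closure (cap n gamma) `\` cap n gamma.
Arguments cap_boundary {R} n gamma.

(** * Calculus on the unit sphere

    A function on (part of) the sphere is given by a total function on R^N of
    which only the values on the sphere are used: every operator below first
    composes it with the radial retraction x |-> x / |x|, whose differential at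
    a point x of the sphere is the orthogonal projection P_x onto the tangent
    space T_x. *)

Definition sph_proj (R : realType) (n : nat) (x : 'rV[R]_n.+1) : 'rV[R]_n.+1 :=
  (enorm x)^-1 *: x.

Definition basis_vec (R : realType) (n : nat) (i : 'I_n.+1) : 'rV[R]_n.+1 :=
  delta_mx ord0 i.

(* At x in the sphere: the derivative of f along the tangent vector P_x e_i. *)
Definition sph_deriv (R : realType) (n : nat) (i : 'I_n.+1)
    (f : 'rV[R]_n.+1 -> R) (x : 'rV[R]_n.+1) : R :=
  'D_(basis_vec R i) (f \o @sph_proj R n) x.

(* The Riemannian gradient, as a vector of R^N tangent to the sphere: its i-th
   coordinate is <grad f, e_i> = df (P_x e_i). *)
Definition sph_grad (R : realType) (n : nat) (f : 'rV[R]_n.+1 -> R)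
    (x : 'rV[R]_n.+1) : 'rV[R]_n.+1 :=
  \row_i sph_deriv i f x.

(* The Riemannian divergence of a tangent field V, i.e. the trace on T_x of
   v |-> P_x (dV v), which equals the sum over i of dV_i (P_x e_i). *)
Definition sph_div (R : realType) (n : nat) (V : 'rV[R]_n.+1 -> 'rV[R]_n.+1)
    (x : 'rV[R]_n.+1) : R :=
  \sum_i sph_deriv i (fun y => V y ord0 i) x.

Definition laplace_beltrami (R : realType) (n : nat) (f : 'rV[R]_n.+1 -> R) :
    'rV[R]_n.+1 -> R :=
  sph_div (sph_grad f).

Definition C1_on (R : realType) (n : nat) (A : set 'rV[R]_n.+1)
    (f : 'rV[R]_n.+1 -> R) : Prop :=
  forall (i : 'I_n.+1) (x : 'rV[R]_n.+1), A x ->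
    derivable f x (basis_vec R i) /\
    {for x, continuous ('D_(basis_vec R i) f)}.

(* For A open. *)
Definition C2_on (R : realType) (n : nat) (A : set 'rV[R]_n.+1)
    (f : 'rV[R]_n.+1 -> R) : Prop :=
  C1_on A f /\ forall i : 'I_n.+1, C1_on A ('D_(basis_vec R i) f).

(* A function on the cap is C^2 iff its degree-0 homogeneous extension is C^2 on
   the open cone over the cap. *)
Definition cap_C2 (R : realType) (n : nat) (gamma : R)
    (u : 'rV[R]_n.+1 -> R) : Prop :=
  C2_on (cone n gamma) (u \o @sph_proj R n).

(** * Dirichlet eigenvalues of minus the Laplace-Beltrami operator on the cap *)

(* Classical eigenfunctions, of class C^2 in the cap and continuous up to the
   boundary. The cap is a smooth domain, so by elliptic regularity these are
   the same as the eigenfunctions in H^1_0. *)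
Definition dirichlet_eigenfunction (R : realType) (n : nat) (gamma lambda : R)
    (u : 'rV[R]_n.+1 -> R) : Prop :=
  [/\ cap_C2 gamma u,
      {within closure (cap n gamma), continuous u},
      forall x, cap_boundary n gamma x -> u x = 0,
      forall x, cap n gamma x -> - laplace_beltrami u x = lambda * u x
    & exists2 x, cap n gamma x & u x != 0].

Definition dirichlet_eigenvalue (R : realType) (n : nat) (gamma : R) : set R :=
  [set lambda | exists u : 'rV[R]_n.+1 -> R,
     dirichlet_eigenfunction gamma lambda u].

Definition first_dirichlet_eigenvalue (R : realType) (n : nat)
    (gamma lambda : R) : Prop :=
  is_least (dirichlet_eigenvalue n gamma) lambda.

(** * Bessel functions of the first kind *)

(* Euler's integral, for s > 0. *)
Definition Gamma (R : realType) (s : R) : R :=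
  \int[@lebesgue_measure R]_(t in `]0, +oo[) (t `^ (s - 1) * expR (- t)).

(* The usual series, for x > 0 and nu > -1 (so that Gamma is only evaluated at
   positive arguments). *)
Definition besselJ (R : realType) (nu x : R) : R :=
  limn (series (fun m : nat =>
    (-1) ^+ m / (m`!%:R * Gamma (m%:R + nu + 1))
      * (x / 2) `^ (2 * m%:R + nu))).

Definition first_positive_zero (R : realType) (f : R -> R) (b : R) : Prop :=
  is_least [set x | 0 < x /\ f x = 0] b.

(* Main.v *)
Require Import Defs.
From mathcomp Require Import all_boot all_order all_algebra.
From mathcomp Require Import all_classical all_reals all_analysis measurable_realfun.
From mathcomp Require Import ring lra.
Set Implicit Arguments.
Unset Strict Implicit.
Unset Printing Implicit Defensive.

Import Order.TTheory GRing.Theory Num.Theory.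
Import numFieldNormedType.Exports.

Local Open Scope classical_set_scope.
Local Open Scope ring_scope.

(** Write [N = d + 2]. The first eigenfunction of the cap is a function of the
    colatitude [t] alone, and on such functions the eigenvalue problem is
    [(sin^d t f')' = - lam sin^d t f], [f (gamma) = 0]. The same problem with the
    weight [t^d] is that of the ball of radius [gamma] in dimension [d + 1], whose
    first eigenvalue is [(B1 / gamma)^2] because its radial solution is
    [t^-nu J_nu (B1 t / gamma)], [nu = (d - 1) / 2]. Both eigenvalues are minima of
    Rayleigh quotients, of energy by mass, and the weights satisfy
    [rho t^d <= sin^d t <= t^d] with [rho = (sin gamma / gamma)^d], since
    [sin t / t] decreases ([sin_le], [sin_ge_chord]). Replacing one weight by the
    other changes each quotient by a factor between [rho] and [rho^-1].

    Minimisers and Sobolev spaces are avoided as follows. The radial solutions on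
    the sphere and in the flat space are members of one hypergeometric family [hg],
    given by power series; the flat one is the Bessel function ([besselJE]), and the
    spherical one extends to a smooth function on the cap which satisfies the
    eigenvalue equation ([zonal_fun_eigen]). Rayleigh quotients are compared
    pointwise, through Picone's identity ([sturm_comparison]).

    For the upper bound, as soon as [mu] exceeds the bound the zonal solution with
    parameter [mu] cannot stay positive on [0, gamma] ([zonal_vanishes]). The last
    parameter below [mu] up to which it does gives a zonal eigenfunction
    ([exists_zonal_first_zero], [zonal_fun_dirichlet]), so the least eigenvalue is
    at most [mu].

    For the lower bound, the zonal solution is positive on [0, gamma] for every
    nonnegative parameter below the bound ([zonal_pos]). A positive solution is a
    barrier: by the maximum principle no eigenfunction of the cap, zonal or not, has
    a smaller eigenvalue ([eigenvalue_ge_zonal]). *)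

(** * Differentiation along a vector *)

Section DerivativeRules.
Variables (R : realType) (V : normedModType R).
Implicit Types (f g : V -> R) (x v : V) (a b k : R).

(** Restriction to a line turns a directional derivative into a one-variable one,
    so that the one-variable chain rule applies. *)
Lemma is_derive_line f x v a :
  is_derive x v f a <-> is_derive (0 : R) 1 (fun h : R => f (h *: v + x)) a.
Proof.
have E : 'D_v f x = 'D_1 (fun h : R => f (h *: v + x)) 0.
  rewrite /derive; congr (lim (_ @ 0^')); apply/funext => h /=.
  by rewrite [h%:A]mulr1 scale0r add0r addr0.
split=> -[df d].
  by apply: DeriveDef; [exact: (iffLR (derivable1P f x v)) df|rewrite -E].
by apply: DeriveDef; [exact: (iffRL (derivable1P f x v)) df|rewrite E].
Qed.

Lemma is_deriveD_fun f g x v a b : is_derive x v f a -> is_derive x v g b ->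
  is_derive x v (fun y => f y + g y) (a + b).
Proof. exact: is_deriveD. Qed.

Lemma is_deriveB_fun f g x v a b : is_derive x v f a -> is_derive x v g b ->
  is_derive x v (fun y => f y - g y) (a - b).
Proof. exact: is_deriveB. Qed.

Lemma is_deriveM_fun f g x v a b : is_derive x v f a -> is_derive x v g b ->
  is_derive x v (fun y => f y * g y) (a * g x + f x * b).
Proof.
move=> df dg; apply: is_derive_eq (is_deriveM df dg) _.
by rewrite /GRing.scale/= addrC [a * _]mulrC.
Qed.

Lemma is_deriveMl_fun k f x v a : is_derive x v f a ->
  is_derive x v (fun y => k * f y) (k * a).
Proof. exact: is_deriveZ. Qed.

Lemma is_derive_comp_fun (F : R -> R) f x v a b : is_derive (f x) 1 F a ->
  is_derive x v f b -> is_derive x v (fun y => F (f y)) (a * b).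
Proof.
move=> dF /is_derive_line df; apply/is_derive_line.
by apply: (@is_derive1_comp _ F (fun h => f (h *: v + x))); rewrite ?scale0r ?add0r.
Qed.

Lemma is_derive_continuous (F : R -> R) (x : R) a :
  is_derive x 1 F a -> {for x, continuous F}.
Proof.
by move=> [dF _]; apply: differentiable_continuous; exact/derivable1_diffP.
Qed.

End DerivativeRules.

(** * Power series *)

Section PowerSeries.
Variable R : realType.
Implicit Types (c d : R^nat) (x w M : R).

Lemma cvg_pseries_bounded c w M x :
  (forall k, `|c k| * w ^+ k <= M) -> `|x| < w -> cvgn (pseries c x).
Proof.
move=> cM xw; have w0 : 0 < w by apply: le_lt_trans xw.
have M0 : 0 <= M by apply: le_trans (cM 0%N); rewrite expr0 mulr1.
apply: normed_cvg.
apply: (@series_le_cvg _ _ (geometric M (`|x| / w))) => [k|k|k|] //=.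
- by rewrite mulr_ge0// exprn_ge0// divr_ge0// ltW.
- rewrite normrM normrX expr_div_n.
  have -> : `|c k| * `|x| ^+ k = (`|c k| * w ^+ k) * (`|x| ^+ k / w ^+ k).
    by field; rewrite expf_neq0// gt_eqF.
  by rewrite ler_wpM2r// divr_ge0// exprn_ge0// ltW.
- apply: is_cvg_geometric_series.
  by rewrite normrM normfV normr_id (gtr0_norm w0) ltr_pdivrMr ?mul1r.
Qed.

(** The geometric sum up to [q^k] has [k + 1] terms, each at least [q^k]. *)
Lemma expr_linear_bounded (q : R) (k : nat) : 0 <= q -> q < 1 ->
  k.+1%:R * q ^+ k <= (1 - q)^-1.
Proof.
move=> q0 q1; have q1' : 0 < 1 - q by rewrite subr_gt0.
rewrite -[leRHS]mul1r ler_pdivlMr//.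
have -> : k.+1%:R * q ^+ k * (1 - q) = \sum_(i < k.+1) (q ^+ k * (1 - q)).
  by rewrite sumr_const card_ord mulr_natl mulrnAl.
have -> : \sum_(i < k.+1) (q ^+ k * (1 - q)) = (1 - q) * \sum_(i < k.+1) q ^+ k.
  by rewrite mulr_sumr; apply: eq_bigr => i _; rewrite mulrC.
apply: (@le_trans _ _ ((1 - q) * \sum_(i < k.+1) q ^+ i)).
  rewrite ler_pM2l//; apply: ler_sum => i _.
  by rewrite ler_wiXn2l// ?ltW// -ltnS.
by rewrite -opprB mulNr -subrX1 opprB gerBl exprn_ge0.
Qed.

Lemma cvg_pseries_diffs c (r x : R) :
  (forall y, `|y| < r -> cvgn (pseries c y)) -> `|x| < r ->
  cvgn (pseries (pseries_diffs c) x).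
Proof.
move=> cc xr; have [w xw wr] : exists2 w : R, `|x| < w & w < r.
  by exists ((`|x| + r) / 2); lra.
have w0 : 0 < w by apply: le_lt_trans xw.
have [v wv vr] : exists2 v : R, w < v & v < r by exists ((w + r) / 2); lra.
have v0 : 0 < v by apply: lt_trans wv.
have /cc : `|v| < r by rewrite gtr0_norm.
move=> /cvg_series_bounded[M [Mr MP]].
have {}MP k : `|c k| * v ^+ k <= M + 1.
  by have := MP (M + 1) (ltr_pwDr ltr01 (lexx _)) k I; rewrite /= normrM normrX (gtr0_norm v0).
have q1 : w / v < 1 by rewrite ltr_pdivrMr ?mul1r.
have q0 : 0 <= w / v by rewrite divr_ge0 // ltW.
apply: (@cvg_pseries_bounded _ w ((1 - w / v)^-1 * ((M + 1) / v))) => // k.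
rewrite /pseries_diffs normrM ger0_norm//.
have -> : k.+1%:R * `|c k.+1| * w ^+ k
    = (k.+1%:R * (w / v) ^+ k) * (`|c k.+1| * v ^+ k.+1 / v).
  by rewrite expr_div_n exprSr; field; rewrite expf_neq0 gt_eqF.
apply: ler_pM; rewrite ?mulr_ge0 ?invr_ge0 ?exprn_ge0 ?(ltW v0) ?(ltW w0)//.
  exact: expr_linear_bounded.
by rewrite ler_wpM2r// invr_ge0 ltW.
Qed.

Lemma is_derive_pseries c (r x : R) :
  (forall y, `|y| < r -> cvgn (pseries c y)) -> `|x| < r ->
  is_derive x 1 (fun y => limn (pseries c y)) (limn (pseries (pseries_diffs c) x)).
Proof.
move=> cc xr; pose w := (`|x| + r) / 2.
have xw : `|x| < w by rewrite /w; lra.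
have wr : `|w| < r.
  by rewrite gtr0_norm; [rewrite /w; lra|apply: le_lt_trans xw].
have dc y : `|y| < r -> cvgn (pseries (pseries_diffs c) y).
  by move=> ?; apply: cvg_pseries_diffs cc _.
apply: (@pseries_snd_diffs _ c w) => //.
- exact: cc.
- exact: dc.
- exact: cvg_pseries_diffs dc _.
- exact: lt_le_trans xw (ler_norm _).
Qed.

Lemma cvg_pseries_mulX c x : cvgn (pseries (pseries_diffs c) x) ->
  pseries (fun k => k%:R * c k) x @ \oo --> x * limn (pseries (pseries_diffs c) x).
Proof.
move=> /pseries_diffs_equiv h.
suff -> : pseries (fun k => k%:R * c k) x
   = (fun n => x * series (fun i => i%:R * c i * x ^+ i.-1) n); first exact: cvgMl_tmp h.
apply/funext => n; rewrite /pseries /series /= mulr_sumr; apply: eq_bigr => -[|k] _.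
  by rewrite !mul0r mulr0.
by rewrite exprS /=; ring.
Qed.

Lemma pseries_norm_le c d (x y : R) : cvgn (pseries d y) ->
  (forall k, `|c k| <= d k) -> `|x| <= y ->
  `|limn (pseries c x)| <= limn (pseries d y).
Proof.
move=> dy cd xy.
have le k : `|c k * x ^+ k| <= d k * y ^+ k.
  rewrite normrM normrX ler_pM// lerXn2r// nnegrE//.
  exact: le_trans xy.
have cn : cvgn [normed pseries c x].
  apply: series_le_cvg dy => k /=; [exact: normr_ge0| |exact: le].
  exact: le_trans (le k).
apply: (le_trans (@lim_series_norm _ R^o _ cn)).
exact: lim_series_le.
Qed.

End PowerSeries.

(** * The hypergeometric family of radial solutions *)

Section Hypergeometric.
Variable R : realType.
Implicit Types (m : nat) (eps lam z : R).

(** For [eps = 1] these are the coefficients of Gauss's series 2F1(a, b; m / 2; z)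
    with [a + b = m - 1] and [a b = - lam]; for [eps = 0], those of 0F1 taken at
    [- lam z], which is a Bessel function. One recurrence covers the sphere and the
    flat space. *)
Fixpoint hgcoef m eps lam (k : nat) : R :=
  if k is j.+1 then hgcoef m eps lam j *
    ((eps * (j%:R * (j%:R + m%:R - 1)) - lam) / (j.+1%:R * (j%:R + m%:R / 2)))
  else 1.

Definition hg m eps lam z := limn (pseries (hgcoef m eps lam) z).

Definition hg1 m eps lam z := limn (pseries (pseries_diffs (hgcoef m eps lam)) z).

Definition hg2 m eps lam z :=
  limn (pseries (pseries_diffs (pseries_diffs (hgcoef m eps lam))) z).

Lemma hgcoefS_norm m eps lam (w : R) k : (0 < m)%N -> 0 <= eps -> 0 <= w -> eps * w < 1 ->
  (0 < k)%N -> (m%:R + `|lam| * w) / (1 - eps * w) <= k%:R ->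
  `|hgcoef m eps lam k.+1| * w <= `|hgcoef m eps lam k|.
Proof.
move=> m0 e0 w0 ew1 k0; rewrite ler_pdivrMr ?subr_gt0// => kl.
have m1 : 1 <= m%:R :> R by rewrite ler1n.
have k1 : 1 <= k%:R :> R by rewrite ler1n.
have kS : k.+1%:R = k%:R + 1 :> R by rewrite -natr1.
have d0 : 0 < k.+1%:R * (k%:R + m%:R / 2) :> R by rewrite kS; nra.
rewrite /= normrM -mulrA ler_piMr// normrM normfV (gtr0_norm d0) mulrAC.
rewrite ler_pdivrMr// mul1r.
have : `|eps * (k%:R * (k%:R + m%:R - 1)) - lam| <=
    eps * (k%:R * (k%:R + m%:R - 1)) + `|lam|.
  rewrite (le_trans (ler_normB _ _))// lerD2r ger0_norm// mulr_ge0// mulr_ge0//.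
  by lra.
move=> /(ler_wpM2r w0) /le_trans; apply.
have ew0 : 0 <= eps * w by rewrite mulr_ge0.
have Lw0 : 0 <= `|lam| * w by rewrite mulr_ge0.
have -> : (eps * (k%:R * (k%:R + m%:R - 1)) + `|lam|) * w =
  (eps * w) * (k%:R * (k%:R + m%:R - 1)) + `|lam| * w by ring.
rewrite kS; move: kl ew1 ew0 Lw0 m1 k1 {kS d0 k0 m0}.
move: (eps * w) (`|lam| * w) (k%:R : R) (m%:R : R) => T L K M kl T1 T0 L0 M1 K1.
have h1 : (M + L) * K <= K * (1 - T) * K by rewrite ler_wpM2r//; lra.
have h2 : L * 1 <= L * K by rewrite ler_wpM2l.
have h3 : T * (K * (M - 1)) <= 1 * (K * (M - 1)).
  by rewrite ler_wpM2r ?(ltW T1)// mulr_ge0//; lra.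
have h4 : 0 <= K * M by rewrite mulr_ge0//; lra.
lra.
Qed.

(** The ratio of consecutive coefficients tends to [eps], so the series converges
    for [|z| < eps^-1]; the form [eps * r <= 1] makes the flat case entire. *)
Lemma cvg_hg m eps lam (r : R) z : (0 < m)%N -> 0 <= eps -> eps * r <= 1 -> `|z| < r ->
  cvgn (pseries (hgcoef m eps lam) z).
Proof.
move=> m0 e0 er zr; pose w := (`|z| + r) / 2.
have z0 : 0 <= `|z| by [].
have zw : `|z| < w by rewrite /w; lra.
have w0 : 0 <= w by rewrite (le_trans z0)// ltW.
have ew1 : eps * w < 1.
  have [->|en0] := eqVneq eps 0; first by rewrite mul0r.
  by rewrite (lt_le_trans _ er)// ltr_pM2l ?lt_def ?en0// /w; lra.
set c := hgcoef m eps lam.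
pose B := (m%:R + `|lam| * w) / (1 - eps * w).
have B0 : 0 <= B.
  by rewrite divr_ge0 ?subr_ge0 ?(ltW ew1)// addr_ge0// mulr_ge0.
pose K := (Num.Def.truncn B).+1.
have KB k : (K <= k)%N -> B <= k%:R.
  move=> Kk; apply: (@le_trans _ _ K%:R); last by rewrite ler_nat.
  by rewrite ltW// truncnS_gt.
pose M := \sum_(i < K.+1) (`|c i| * w ^+ i).
have cw0 i : 0 <= `|c i| * w ^+ i by rewrite mulr_ge0// exprn_ge0.
have low k : (k <= K)%N -> `|c k| * w ^+ k <= M.
  rewrite -ltnS => kK; rewrite /M (bigD1 (Ordinal kK))//= lerDl.
  exact: sumr_ge0.
apply: (@cvg_pseries_bounded _ _ w M) => // k.
elim: k => [|k IH]; first exact: low.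
have [/low//|Kk] := leqP k.+1 K.
rewrite (le_trans _ IH)// exprS mulrA ler_wpM2r ?exprn_ge0//.
by apply: hgcoefS_norm => //; [exact: (@leq_trans K)|exact: KB].
Qed.

Lemma hg0 m eps lam : hg m eps lam 0 = 1.
Proof.
apply: lim_near_cst => //; near=> k; have k0 : (0 < k)%N by near: k; exists 1%N.
rewrite -(prednK k0) /pseries /series /= big_nat_recl//= expr0 mulr1.
by rewrite big1 ?addr0// => i _; rewrite exprS mul0r mulr0.
Unshelve. all: by end_near. Qed.

Section Disc.
Variables (m : nat) (eps lam r : R).
Hypotheses (m0 : (0 < m)%N) (eps0 : 0 <= eps) (er : eps * r <= 1).

Let c := hgcoef m eps lam.
Let cvgc z : `|z| < r -> cvgn (pseries c z).
Proof. exact: cvg_hg. Qed.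
Let cvgd z : `|z| < r -> cvgn (pseries (pseries_diffs c) z).
Proof. exact: cvg_pseries_diffs. Qed.

Lemma is_derive_hg z : `|z| < r -> is_derive z 1 (hg m eps lam) (hg1 m eps lam z).
Proof. by move=> zr; exact: is_derive_pseries zr. Qed.

Lemma is_derive_hg1 z : `|z| < r -> is_derive z 1 (hg1 m eps lam) (hg2 m eps lam z).
Proof. by move=> zr; exact: is_derive_pseries cvgd zr. Qed.

Lemma continuous_hg2 z : `|z| < r -> {for z, continuous (hg2 m eps lam)}.
Proof.
move=> zr; apply: differentiable_continuous; apply/derivable1_diffP.
have ce y : `|y| < r -> cvgn (pseries (pseries_diffs (pseries_diffs c)) y).
  exact: cvg_pseries_diffs.
by have [] := is_derive_pseries ce zr.
Qed.

Lemma hg_ode z : `|z| < r ->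
  z * (1 - eps * z) * hg2 m eps lam z +
  m%:R / 2 * (1 - 2 * eps * z) * hg1 m eps lam z + lam * hg m eps lam z = 0.
Proof.
move=> zr; pose d := pseries_diffs c.
have cF : pseries c z @ \oo --> hg m eps lam z by exact: cvgc.
have cF1 : pseries d z @ \oo --> hg1 m eps lam z by exact: cvgd.
have cxF1 : pseries (fun k => k%:R * c k) z @ \oo --> z * hg1 m eps lam z.
  by apply: cvg_pseries_mulX; exact: cvgd.
have ce y : `|y| < r -> cvgn (pseries (pseries_diffs d) y).
  exact: cvg_pseries_diffs.
have cxF2 : pseries (fun k => k%:R * d k) z @ \oo --> z * hg2 m eps lam z.
  by apply: cvg_pseries_mulX; exact: ce.
(* the coefficients of (z F')' = F' + z F'' are those of the derivative of
   sum k c_k z^k *)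
have cxF1' : pseries (pseries_diffs (fun k => k%:R * c k)) z @ \oo -->
    hg1 m eps lam z + z * hg2 m eps lam z.
  suff -> : pseries (pseries_diffs (fun k => k%:R * c k)) z =
      (fun n => pseries d z n + pseries (fun k => k%:R * d k) z n) by exact: cvgD.
  apply/funext => n.
  rewrite /pseries /series /= -big_split; apply: eq_bigr => k _ /=.
  by rewrite /d /pseries_diffs -natr1; ring.
have cx2F2 : pseries (fun k => k%:R * (k%:R * c k)) z @ \oo -->
    z * (hg1 m eps lam z + z * hg2 m eps lam z).
  by rewrite -(cvg_lim _ cxF1')//; apply: cvg_pseries_mulX; exact: cvgP cxF1'.
have sum0 n : pseries (fun k => k%:R * d k) z n + m%:R / 2 * pseries d z n -
    eps * (pseries (fun k => k%:R * (k%:R * c k)) z n +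
           (m%:R - 1) * pseries (fun k => k%:R * c k) z n) +
    lam * pseries c z n = 0.
  rewrite /pseries /series /= !mulr_sumr -!big_split/= mulr_sumr -sumrB -big_split/=.
  rewrite big1// => k _; rewrite /d /pseries_diffs /c /= -natr1.
  set ck := hgcoef m eps lam k.
  have m1 : 0 < m%:R :> R by rewrite ltr0n.
  have k0 : 0 <= k%:R :> R by [].
  by field; rewrite !gt_eqF//=; lra.
have E : z * (1 - eps * z) * hg2 m eps lam z +
    m%:R / 2 * (1 - 2 * eps * z) * hg1 m eps lam z + lam * hg m eps lam z =
    z * hg2 m eps lam z + m%:R / 2 * hg1 m eps lam z -
    eps * (z * (hg1 m eps lam z + z * hg2 m eps lam z) +
           (m%:R - 1) * (z * hg1 m eps lam z)) +
    lam * hg m eps lam z by field.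
suff lim0 : (fun=> 0 : R) @ \oo -->
    (z * (1 - eps * z) * hg2 m eps lam z +
     m%:R / 2 * (1 - 2 * eps * z) * hg1 m eps lam z + lam * hg m eps lam z).
  by rewrite -(cvg_lim _ lim0)// lim_cst.
rewrite E (_ : (fun=> 0) = (fun n => pseries (fun k => k%:R * d k) z n +
    m%:R / 2 * pseries d z n - eps * (pseries (fun k => k%:R * (k%:R * c k)) z n +
           (m%:R - 1) * pseries (fun k => k%:R * c k) z n) +
    lam * pseries c z n)); last by apply/funext => n; rewrite sum0.
apply: cvgD; last exact: cvgMl_tmp.
apply: cvgB; first by apply: cvgD => //; exact: cvgMl_tmp.
by apply: cvgMl_tmp; apply: cvgD => //; exact: cvgMl_tmp.
Qed.

End Disc.

Section Lipschitz.
Variables (m : nat) (eps : R).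
Hypotheses (m0 : (0 < m)%N) (eps0 : 0 <= eps).

Let b (k : nat) : R := eps * (k%:R * (k%:R + m%:R - 1)).
Let a (k : nat) : R := (k.+1%:R * (k%:R + m%:R / 2))^-1.

Let m1 : 1 <= m%:R :> R. Proof. by rewrite ler1n. Qed.

Let b0 k : 0 <= b k.
Proof.
have : 0 <= k%:R :> R by []. move: m1 => M1 K0.
by rewrite /b mulr_ge0// mulr_ge0//; lra.
Qed.

Let a0 k : 0 < a k.
Proof.
have K0 : 0 <= k%:R :> R by [].
by rewrite invr_gt0 mulr_gt0// ltr_wpDl// divr_gt0// ltr0n.
Qed.

Lemma hgcoef_majorant lam (L : R) k : `|lam| <= L ->
  `|hgcoef m eps lam k| <= hgcoef m eps (- L) k.
Proof.
move=> lL; elim: k => [|k IH] /=; first by rewrite normr1.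
rewrite normrM ler_pM// -/(b k) -/(a k) opprK normrM (gtr0_norm (a0 k)).
rewrite ler_wpM2r ?(ltW (a0 k))//.
by rewrite (le_trans (ler_normB _ _))// ger0_norm// lerD2l.
Qed.

(** The majorant has nonnegative coefficients as a polynomial in [L], so a unit
    increment of it dominates its derivative at [L], hence every slope in [lam]
    on [-L, L]. *)
Lemma hgcoef_lipschitz lam1 lam2 (L : R) k : `|lam1| <= L -> `|lam2| <= L ->
  `|hgcoef m eps lam1 k - hgcoef m eps lam2 k| <=
  `|lam1 - lam2| * (hgcoef m eps (- (L + 1)) k - hgcoef m eps (- L) k).
Proof.
move=> l1 l2; elim: k => [|k IH]; first by rewrite /= !subrr normr0 mulr0.
have c1 := hgcoef_majorant k l1; have c2 := hgcoef_majorant k l2.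
have L0 : 0 <= L by apply: le_trans l1.
have c12 : hgcoef m eps (- L) k <= hgcoef m eps (- (L + 1)) k.
  apply: le_trans (ler_norm _) _; apply: hgcoef_majorant.
  by rewrite normrN ger0_norm//; lra.
rewrite /= -/(b k) -!/(a k) !opprK.
set x1 := hgcoef m eps lam1 k in IH c1 *; set x2 := hgcoef m eps lam2 k in IH c2 *.
set q1 := hgcoef m eps (- L) k in IH c1 c2 c12 *.
set q2 := hgcoef m eps (- (L + 1)) k in IH c12 *.
have -> : x1 * ((b k - lam1) * a k) - x2 * ((b k - lam2) * a k) =
  a k * ((b k - lam1) * (x1 - x2) - (lam1 - lam2) * x2) by ring.
have -> : `|lam1 - lam2| * (q2 * ((b k + (L + 1)) * a k) - q1 * ((b k + L) * a k)) =
  a k * ((b k + L) * (`|lam1 - lam2| * (q2 - q1)) + `|lam1 - lam2| * q2) by ring.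
rewrite normrM (gtr0_norm (a0 k)) ler_wpM2l ?(ltW (a0 k))//.
rewrite (le_trans (ler_normB _ _))// !normrM lerD//.
  rewrite ler_pM// (le_trans (ler_normB _ _))// ger0_norm// lerD2l//.
by rewrite ler_wpM2l// (le_trans c2).
Qed.

(** The constant does not depend on [z], which makes the set of parameters for
    which the solution is positive on a segment relatively open. *)
Lemma hg_lipschitz lam1 lam2 (L z Z r : R) : eps * r <= 1 -> Z < r ->
  `|lam1| <= L -> `|lam2| <= L -> `|z| <= Z ->
  `|hg m eps lam1 z - hg m eps lam2 z| <=
  `|lam1 - lam2| * hg m eps (- (L + 1)) Z.
Proof.
move=> er Zr l1 l2 zZ; have Z0 : 0 <= Z by apply: le_trans zZ.
have cv lam x : `|x| <= Z -> cvgn (pseries (hgcoef m eps lam) x).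
  by move=> xZ; exact: cvg_hg m0 eps0 er (le_lt_trans xZ Zr).
have ZZ : `|Z| <= Z by rewrite ger0_norm.
have -> : hg m eps lam1 z - hg m eps lam2 z =
    limn (pseries (fun k => hgcoef m eps lam1 k - hgcoef m eps lam2 k) z).
  apply/esym/cvg_lim => //.
  rewrite (_ : pseries _ z = (fun n => pseries (hgcoef m eps lam1) z n -
      pseries (hgcoef m eps lam2) z n)); first by apply: cvgB; exact: cv.
  apply/funext => n; rewrite /pseries /series /= -sumrB; apply: eq_bigr => k _.
  by rewrite mulrBl.
have cd : (fun n => `|lam1 - lam2| * pseries (hgcoef m eps (- (L + 1))) Z n) @ \oo -->
    `|lam1 - lam2| * hg m eps (- (L + 1)) Z by apply: cvgMl_tmp; exact: cv.
have Ed : pseries (fun k => `|lam1 - lam2| * hgcoef m eps (- (L + 1)) k) Z =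
    (fun n => `|lam1 - lam2| * pseries (hgcoef m eps (- (L + 1))) Z n).
  apply/funext => n; rewrite /pseries /series /= mulr_sumr; apply: eq_bigr => k _.
  by rewrite mulrA.
have L0 : 0 <= L by apply: le_trans l1.
rewrite -(cvg_lim _ cd)// -Ed; apply: pseries_norm_le => //.
  by rewrite Ed; apply: cvgP cd.
move=> k; rewrite (le_trans (hgcoef_lipschitz _ l1 l2))// ler_wpM2l//.
have : `|hgcoef m eps (- L) k| <= hgcoef m eps (- L) k.
  by apply: hgcoef_majorant; rewrite normrN ger0_norm.
by move/(le_trans (normr_ge0 _)); lra.
Qed.

End Lipschitz.

(** In the flat case only the product of [lam] and [z] matters, which is how one
    Bessel function serves the balls of all radii. *)
Lemma hg_scale m lam z : hg m 0 lam z = hg m 0 1 (lam * z).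
Proof.
congr (limn _); apply/funext => n; rewrite /pseries /series /=.
apply: eq_bigr => k _; rewrite exprMn mulrA; congr (_ * _).
elim: k => [|k IH] /=; first by rewrite mulr1.
by rewrite IH exprSr !mul0r !sub0r mulNr; ring.
Qed.

End Hypergeometric.

(** * Euler's Gamma function *)

Section GammaFunction.
Variable R : realType.
Implicit Types (a s t x : R).

Let mu := @lebesgue_measure R.

Lemma within_continuous_powR a : 0 <= a ->
  {within `[0, +oo[, continuous (fun t : R => t `^ a)}.
Proof.
move=> a0; apply/continuous_within_itvcyP; split=> [t t0|].
  apply: differentiable_continuous; apply/derivable1_diffP.
  exact: derivable_powR.
move: a0; rewrite le_eqVlt => /predU1P[<-|a0].
  by rewrite powRr0; under eq_cvg do rewrite powRr0; exact: cvg_cst.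
by rewrite powR0 ?gt_eqF//; exact: powR_cvg0.
Qed.

(** One bound for both the integrability of Euler's integrand and the vanishing at
    infinity of its antiderivative terms. *)
Lemma powR_expR_le a : 0 <= a ->
  exists2 C : R, 0 < C & forall t, 0 <= t -> t `^ a * expR (- t) <= C * expR (- t / 2).
Proof.
move=> a0; pose k := Num.Def.truncn a.
have ak : a <= k.+1%:R by rewrite ltW// truncnS_gt.
pose C : R := 1 + 2 ^+ k.+1 * k.+1`!%:R; exists C.
  by rewrite /C ltr_wpDr.
move=> t t0; have tE : expR (- t) = expR (- t / 2) * expR (- t / 2).
  by rewrite -expRD; congr expR; field.
rewrite tE mulrA ler_wpM2r ?expR_ge0//.
have -> : expR (- t / 2) = (expR (t / 2))^-1 by rewrite -expRN; congr expR; field.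
rewrite ler_pdivrMr ?expR_gt0//.
have e1 : 1 + (t / 2) ^+ k.+1 / k.+1`!%:R <= expR (t / 2).
  by apply: expR_ge1Dxn; rewrite divr_ge0.
have f0 : 0 < k.+1`!%:R :> R by rewrite ltr0n fact_gt0.
have x0 : 0 <= (t / 2) ^+ k.+1 / k.+1`!%:R by rewrite divr_ge0 ?exprn_ge0 ?divr_ge0// ltW.
have C0 : 0 <= C by rewrite /C addr_ge0 ?mulr_ge0 ?exprn_ge0.
apply: (@le_trans _ _ (C * (1 + (t / 2) ^+ k.+1 / k.+1`!%:R))); last first.
  by rewrite ler_wpM2l.
apply: (@le_trans _ _ (1 + t ^+ k.+1)).
  have [t1|t1] := leP t 1.
    apply: (@le_trans _ _ 1); last by rewrite lerDl exprn_ge0.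
    move: t0; rewrite le_eqVlt => /predU1P[<-|t0].
      have [->|an0] := eqVneq a 0; first by rewrite powRr0.
      by rewrite powR0.
    have <- : 1 `^ a = 1 :> R by rewrite powR1.
    by apply: ge0_ler_powR => //; rewrite nnegrE// ltW.
  rewrite (le_trans (ler_powR (ltW t1) ak))// powR_mulrn//.
  by rewrite lerDr.
have -> : t ^+ k.+1 = (2 ^+ k.+1 * k.+1`!%:R) * ((t / 2) ^+ k.+1 / k.+1`!%:R).
  by rewrite expr_div_n; field; rewrite ?expf_neq0 ?gt_eqF.
set u := _ / _ in x0 *; rewrite /C; set v : R := 2 ^+ k.+1 * _.
have v0 : 0 <= v by rewrite mulr_ge0 ?exprn_ge0.
have : 0 <= v * u by rewrite mulr_ge0.
lra.
Qed.

Lemma integrable_Gamma s : 1 <= s ->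
  mu.-integrable `[0, +oo[ (EFin \o (fun t => t `^ (s - 1) * expR (- t))).
Proof.
move=> s1; have a0 : 0 <= s - 1 by rewrite subr_ge0.
have [C C0 Cle] := powR_expR_le a0.
have h0 : (0 < 2^-1 :> R) by rewrite invr_gt0.
have hint := integrable_exponential_pdf h0.
have hint0 : mu.-integrable `[0, +oo[ (EFin \o exponential_pdf 2^-1).
  by apply: integrableS hint.
apply: (@le_integrable _ _ _ mu `[0, +oo[ (measurable_itv _) _
  (fun t => (C * 2)%:E * (EFin \o exponential_pdf 2^-1) t)%E) => //.
- apply/measurable_EFinP; apply: measurable_funTS; apply: measurable_funM.
    exact: measurable_powR.
  by apply: measurableT_comp => //; exact: measurable_funN.
- move=> t /=; rewrite in_itv/= andbT => t0.
  rewrite lee_fin exponential_pdfE// ger0_norm ?mulr_ge0 ?powR_ge0 ?expR_ge0//.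
  rewrite ger0_norm; last by rewrite !mulr_ge0 ?expR_ge0// ltW.
  apply: (le_trans (Cle _ t0)); rewrite mulrA mulfK//.
  by rewrite (_ : - t / 2 = - 2^-1 * t)//; ring.
- exact: integrableZl.
Qed.

Lemma Gamma_cc s : 1 <= s ->
  Gamma s = \int[mu]_(t in `[0, +oo[) (t `^ (s - 1) * expR (- t)).
Proof.
move=> s1; rewrite /Gamma Rintegral_itv_obnd_cbnd//.
apply: integrableS (integrable_Gamma s1) => //.
by apply: subset_itvr; rewrite bnd_simp.
Qed.

Lemma Gamma_gt0 s : 1 <= s -> 0 < Gamma s.
Proof.
move=> s1; rewrite Gamma_cc//.
have int := integrable_Gamma s1.
apply: (@lt_le_trans _ _ (\int[mu]_(t in `[1, 2]) expR (- 2))).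
  have mu12 : fine (mu `[1, 2]) = 1.
    rewrite /mu lebesgue_measure_itv/= lte_fin ltr1n/=.
    by rewrite -[1]/(1%:R) -natrB.
  by rewrite Rintegral_cst// mu12 mulr1 expR_gt0.
have int12 : mu.-integrable `[1, 2] (EFin \o (fun t => t `^ (s - 1) * expR (- t))).
  apply: integrableS int => //.
  by move=> t /=; rewrite !in_itv/= andbT => /andP[+ _]; lra.
have intc : mu.-integrable `[1, 2] (EFin \o (fun=> expR (- 2) : R)).
  apply: continuous_compact_integrable; first exact: segment_compact.
  by apply: continuous_subspaceT => ?; exact: cvg_cst.
apply: (@le_trans _ _ (\int[mu]_(t in `[1, 2]) (t `^ (s - 1) * expR (- t)))).
  apply: le_Rintegral => // t /=; rewrite in_itv/= => /andP[t1 t2].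
  rewrite -[leLHS]mul1r ler_pM ?expR_ge0 ?ler_expR ?lerN2//.
  by rewrite -[leLHS](powRr0 t) ler_powR// subr_ge0.
rewrite fine_le ?integrable_fin_num//.
apply: ge0_subset_integral => //.
- by apply/measurable_EFinP; case/integrableP : int => /measurable_EFinP.
- by move=> t _; rewrite lee_fin mulr_ge0 ?powR_ge0 ?expR_ge0.
- by move=> t /=; rewrite !in_itv/= andbT => /andP[+ _]; lra.
Qed.

(** The derivative of [- t^s e^-t] integrates to 0, as this function vanishes at
    both ends. The derivative changes sign at [t = s] only; cutting there makes the
    integrand of the improper part nonnegative. *)
Lemma GammaS s : 1 <= s -> Gamma (s + 1) = s * Gamma s.
Proof.
move=> s1; have s0 : 0 < s by apply: lt_le_trans s1.
have s1' : 1 <= s + 1 by rewrite lerDr ltW.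
rewrite !Gamma_cc// addrK.
pose f t : R := t `^ s * expR (- t).
pose g t : R := t `^ (s - 1) * expR (- t).
have intf : mu.-integrable `[0, +oo[ (EFin \o f).
  by have := integrable_Gamma s1'; rewrite addrK.
have intg : mu.-integrable `[0, +oo[ (EFin \o g) := integrable_Gamma s1.
have intsg : mu.-integrable `[0, +oo[ (EFin \o (fun t => s * g t)).
  by rewrite (_ : _ \o _ = (fun t => s%:E * (EFin \o g) t)%E)//; exact: integrableZl.
pose h t := f t - s * g t.
have inth : mu.-integrable `[0, +oo[ (EFin \o h).
  rewrite (_ : _ \o _ = (fun t => (EFin \o f) t - (EFin \o (fun t => s * g t)%R) t)%E)//.
  exact: integrableB.
suff h0 : \int[mu]_(t in `[0, +oo[) h t = 0.
  apply/eqP; rewrite -subr_eq0 -RintegralZl// -RintegralB//.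
  exact/eqP.
pose F t : R := - (t `^ s * expR (- t)).
have dF t : 0 < t -> is_derive t 1 F (h t).
  move=> t0; have dp : is_derive t 1 (fun t : R => t `^ s) (s * t `^ (s - 1)).
    have t0y : t \in `]0, +oo[ by rewrite in_itv/= t0.
    apply: DeriveDef; first exact: derivable_powR.
    by rewrite -derive1E powR_derive1.
  have de : is_derive t 1 (fun t : R => expR (- t)) (- expR (- t)).
    have h1 := @is_derive1_comp R (@expR R) -%R t _ _ (is_derive_expR _) _.
    by apply: is_derive_eq; exact: mulrN1.
  by apply: is_derive_eq; rewrite /h /f /g /GRing.scale/=; ring.
have ce : continuous (fun t : R => expR (- t)).
  move=> t; apply: continuous_comp; first exact: opp_continuous.
  exact: continuous_expR.
have cpe (a : R) : 0 <= a -> {within `[0, +oo[, continuous (fun t : R => t `^ a * expR (- t))}.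
  move=> a0 t; apply: cvgM; first exact: within_continuous_powR.
  exact: continuous_subspaceT.
have ch : {within `[0, +oo[, continuous h}.
  move=> t; apply: cvgB; first exact: cpe (ltW s0) _.
  by apply: cvgMl_tmp; apply: cpe; rewrite subr_ge0.
have cF : {within `[0, +oo[, continuous F}.
  by move=> t; apply: cvgN; exact: cpe (ltW s0) _.
have F0 : F 0 = 0 by rewrite /F powR0 ?gt_eqF// mul0r oppr0.
have Fy : F t @[t --> +oo] --> 0.
  have [C C0 Cle] := powR_expR_le (ltW s0).
  have half : (t / 2) @[t --> +oo%R] --> (+oo%R : set_system R).
    by apply/cvgryPge => A; near=> t; rewrite ler_pdivlMr//.
  have lim : - (C * expR (- (t / 2))) @[t --> +oo%R] --> (0 : R).
    rewrite -oppr0 -(mulr0 C); apply: cvgN; apply: cvgMl_tmp.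
    exact: (cvg_comp _ _ half (@cvgr_expR R)).
  apply: (squeeze_cvgr _ lim (cvg_cst 0)); near=> t.
  have t0 : 0 <= t by near: t; exact: nbhs_pinfty_ge.
  rewrite /F lerN2 oppr_le0 mulr_ge0 ?powR_ge0 ?expR_ge0// andbT.
  by rewrite -mulNr; exact: Cle.
have E1 : \int[mu]_(t in `[0, s]) h t = F s - F 0.
  rewrite /Rintegral (@continuous_FTC2 _ h F)//.
  - by apply: continuous_subspaceW ch; exact: subset_itvl.
  - have /(continuous_within_itvP _ s0)[_ F0r Fs] : {within `[0, s], continuous F}.
      by apply: continuous_subspaceW cF; exact: subset_itvl.
    split=> // t; rewrite in_itv/= => /andP[t0 _].
    by have [] := dF _ t0.
  - move=> t; rewrite in_itv/= => /andP[t0 _].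
    by rewrite derive1E; have [] := dF _ t0.
have E2 : \int[mu]_(t in `[s, +oo[) h t = 0 - F s.
  apply: Rintegral_ge0_continuous_FTC2y => //.
  - move=> t st; have t0 : 0 < t by apply: lt_le_trans st.
    rewrite /h /f /g mulrA -mulrBl mulr_ge0 ?expR_ge0//.
    by rewrite -(mulr_powRB1 (ltW t0) s0) -mulrBl mulr_ge0 ?powR_ge0 ?subr_ge0.
  - apply: continuous_subspaceW ch; apply: subset_itvr; rewrite bnd_simp; exact: ltW.
  - by move=> t st; have [] := dF _ (lt_trans s0 st).
  - apply: cvg_at_right_filter; apply: differentiable_continuous.
    by apply/derivable1_diffP; have [] := dF _ s0.
  - move=> t; rewrite in_itv/= andbT => st.
    by rewrite derive1E; have [] := dF _ (lt_trans s0 st).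
have := @Rintegral_itvB _ h (BLeft 0) +oo%O s inth.
rewrite !bnd_simp => /(_ (ltW s0) isT).
rewrite Rintegral_itv_obnd_cbnd; last first.
  by apply: integrableS inth => //; apply: subset_itvr; rewrite bnd_simp ltW.
rewrite -!/mu E1 E2 F0; lra.
Unshelve. all: by end_near. Qed.

End GammaFunction.

(** * Bessel functions as flat radial solutions *)

Section Bessel.
Variable R : realType.
Implicit Types (m k : nat) (x B : R).

Lemma hgcoef_Gamma m k : (2 <= m)%N ->
  (-1) ^+ k / (k`!%:R * Gamma (k%:R + m%:R / 2)) =
  hgcoef m 0 1 k / Gamma (m%:R / 2) :> R.
Proof.
move=> m2; have m2R : 1 <= m%:R / 2 :> R by rewrite ler_pdivlMr// mul1r ler_nat.
have km j : 1 <= j%:R + m%:R / 2 :> R by rewrite (le_trans m2R)// lerDr.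
have G0 j : Gamma (j%:R + m%:R / 2) != 0 :> R by rewrite gt_eqF// Gamma_gt0.
have G : Gamma (m%:R / 2) != 0 :> R by rewrite gt_eqF// Gamma_gt0.
elim: k => [|k IH]; first by rewrite /= expr0 fact0 !mul1r add0r.
have S : k.+1%:R + m%:R / 2 = (k%:R + m%:R / 2) + 1 :> R by rewrite -natr1; ring.
rewrite S GammaS// factS natrM exprS [hgcoef m 0 1 k.+1]/= [RHS]mulrAC -IH -natr1.
have k0 : 0 <= k%:R :> R by [].
have F0 : k`!%:R != 0 :> R by rewrite pnatr_eq0 -lt0n fact_gt0.
have m0 : 0 < m%:R :> R by rewrite ltr0n (leq_trans _ m2).
by field; rewrite G0 F0 !gt_eqF//=; lra.
Qed.

(** With [nu + 1 = m / 2], the factor in front never vanishes: [besselJ nu] and the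
    flat solution have the same positive zeros. *)
Lemma besselJE m x : (2 <= m)%N -> 0 < x ->
  besselJ ((m%:R - 2) / 2) x =
  (x / 2) `^ ((m%:R - 2) / 2) / Gamma (m%:R / 2) * hg m 0 1 (x ^+ 2 / 4).
Proof.
move=> m2 x0; have m0 : (0 < m)%N by apply: leq_trans m2.
set nu : R := (m%:R - 2) / 2; set K := _ / Gamma _.
have cv : cvgn (pseries (hgcoef m 0 1) (x ^+ 2 / 4)).
  apply: (@cvg_hg _ _ _ _ (x ^+ 2 / 4 + 1)) => //; first by rewrite mul0r.
  by rewrite ger0_norm ?ltrDl ?ltr01// divr_ge0 ?sqr_ge0.
have /cvg_lim <- // : (fun n => K * pseries (hgcoef m 0 1) (x ^+ 2 / 4) n) @ \oo -->
    K * hg m 0 1 (x ^+ 2 / 4) by exact: cvgMl_tmp.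
rewrite /besselJ; congr (limn _); apply/funext => n.
rewrite /pseries /series /= mulr_sumr; apply: eq_bigr => k _.
have -> : k%:R + nu + 1 = k%:R + m%:R / 2 :> R by rewrite /nu; field.
rewrite hgcoef_Gamma// powRD; last by rewrite (gt_eqF (_ : 0 < x / 2)) ?implybT// divr_gt0.
rewrite -natrM powR_mulrn ?divr_ge0 ?(ltW x0)// exprM expr_div_n.
have -> : (2 ^+ 2 : R) = 4 by ring.
by rewrite /K; ring.
Qed.

Lemma first_zero_pos (f : R -> R) B : 0 < f 0 ->
  (forall x, 0 <= x -> x < B -> {for x, continuous f}) ->
  (forall x, 0 < x -> x < B -> f x != 0) ->
  forall x, 0 <= x -> x < B -> 0 < f x.
Proof.
move=> f0 cf fn x x0 xB; rewrite ltNge; apply/negP => fx.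
have [||c] := @IVT _ f 0 x 0 x0.
- apply: continuous_in_subspaceT => y; rewrite inE/= in_itv/= => /andP[y0 yx].
  by apply: cf => //; exact: le_lt_trans xB.
- by rewrite ge_min le_max fx (ltW f0) orbT.
- rewrite in_itv/= => /andP[c0 cx] fc.
  have [c00|cn] := eqVneq c 0; first by move: fc f0; rewrite c00 => ->; rewrite ltxx.
  have c00 : 0 < c by rewrite lt_def cn.
  by move: (fn c c00 (le_lt_trans cx xB)); rewrite fc eqxx.
Qed.

Lemma first_positive_zero_hg m B : (2 <= m)%N ->
  first_positive_zero (besselJ ((m%:R - 2) / 2)) B ->
  [/\ 0 < B, hg m 0 1 (B ^+ 2 / 4) = 0 &
    forall x, 0 <= x -> x < B -> 0 < hg m 0 1 (x ^+ 2 / 4)].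
Proof.
move=> m2 [[B0 JB] lb]; have m0 : (0 < m)%N by apply: leq_trans m2.
have K0 x : 0 < x -> (x / 2) `^ ((m%:R - 2) / 2) / Gamma (m%:R / 2) != 0.
  move=> x0; rewrite gt_eqF// divr_gt0 ?powR_gt0 ?divr_gt0//.
  by apply: Gamma_gt0; rewrite ler_pdivlMr// mul1r ler_nat.
split=> //.
  by move/eqP: JB; rewrite besselJE// mulf_eq0 (negPf (K0 _ B0)) => /eqP.
apply: first_zero_pos; first by rewrite expr0n mul0r hg0.
  move=> x x0 xB; apply: (@continuous_comp _ _ _ (fun x => x ^+ 2 / 4) (hg m 0 1)).
    by apply: cvgMr_tmp; exact: exprn_continuous.
  apply: is_derive_continuous; apply: (@is_derive_hg _ _ _ _ (x ^+ 2 / 4 + 1)) => //.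
    by rewrite mul0r.
  by rewrite ger0_norm ?ltrDl ?ltr01// divr_ge0 ?sqr_ge0.
move=> x x0 xB; apply/eqP => h0; have : (B <= x) by apply: lb; rewrite /= besselJE// h0 mulr0.
by rewrite leNgt xB.
Qed.

End Bessel.

(** * Sturm comparison *)

Section Comparison.
Variable R : realType.
Implicit Types (f df g dg w : R -> R) (a b lam kap rho gamma t x : R).

Lemma within_continuous_is_derive f df a b :
  (forall x, a <= x <= b -> is_derive x 1 f (df x)) -> {within `[a, b], continuous f}.
Proof.
move=> d; apply: derivable_within_continuous => x; rewrite in_itv/= => xab.
by have [] := d x xab.
Qed.

Lemma mean_value f df a b : a < b ->
  (forall x, a <= x <= b -> is_derive x 1 f (df x)) ->
  exists2 c, a < c < b & f b - f a = df c * (b - a).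
Proof.
move=> ab d; have [|c] := @MVT R f df a b ab _ (within_continuous_is_derive d).
  by move=> x; rewrite in_itv/= => /andP[ax xb]; apply: d; rewrite !ltW.
by rewrite in_itv/= => cab E; exists c.
Qed.

Lemma is_derive_nincr f df a b : (forall x, a <= x <= b -> is_derive x 1 f (df x)) ->
  (forall x, a < x < b -> df x <= 0) ->
  forall x y, a <= x -> x <= y -> y <= b -> f y <= f x.
Proof.
move=> d dn x y ax; rewrite le_eqVlt => /predU1P[->//|xy] yb.
have [|c /andP[xc cy] E] := @mean_value f df x y xy.
  by move=> z /andP[xz zy]; apply: d; rewrite (le_trans ax)//= (le_trans zy).
rewrite -subr_le0 E mulr_le0_ge0 ?subr_ge0 ?(ltW xy)//.
by rewrite dn// (le_lt_trans ax)//= (lt_le_trans cy).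
Qed.

(** [(w f')' = - lam w f] on [0, b], with [df] for [f']. The weight vanishes at 0,
    where the equation is singular, so the flux [w df] does too and no boundary term
    arises there. *)
Definition sturm_solution w f df lam b :=
  [/\ w 0 = 0,
      forall x, 0 <= x <= b -> is_derive x 1 f (df x)
    & forall x, 0 <= x <= b ->
        is_derive x 1 (fun t => w t * df t) (- (lam * (w x * f x)))].

(** A comparison of Rayleigh quotients without integrals. Picone's identity with the
    positive [g] says that the energy of [f] for the weight [rho * w2] is at least
    [kap] times its mass; but [f], which vanishes at [b], has the energy [lam] times
    its mass for the weight [w1], and the two weights make this too small. *)
Lemma sturm_comparison (w1 w2 f df g dg : R -> R) lam kap rho b : 0 < b -> 0 <= rho ->
  sturm_solution w1 f df lam b -> sturm_solution w2 g dg kap b ->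
  (forall x, 0 < x < b -> [/\ 0 <= w2 x, rho * w2 x <= w1 x
                            & lam * w1 x < rho * kap * w2 x]) ->
  (forall x, 0 < x < b -> f x != 0) -> f b = 0 ->
  ~ (forall x, 0 <= x <= b -> 0 < g x).
Proof.
move=> b0 rho0 [w10 df' dF] [w20 dg' dG] w12 fn fb gp.
(* Picone's function: its derivative is minus a square plus the difference of
   the two energy densities *)
pose H x := rho * (f x * (f x * (w2 x * dg x * (g x)^-1))) - f x * (w1 x * df x).
pose dH x := - (rho * w2 x * (df x - f x * (dg x / g x)) ^+ 2)
  - (w1 x - rho * w2 x) * df x ^+ 2 - (rho * kap * w2 x - lam * w1 x) * f x ^+ 2.
have HdH x : 0 <= x <= b -> is_derive x 1 H (dH x).
  move=> xb; have fx := df' x xb; have gx := dg' x xb.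
  have Fx := dF x xb; have Gx := dG x xb; have g0 := gp x xb.
  have g00 : g x != 0 by rewrite gt_eqF.
  have iv := is_deriveV g00 gx.
  apply: is_derive_eq (is_deriveB_fun (is_deriveMl_fun rho (is_deriveM_fun fx
    (is_deriveM_fun fx (is_deriveM_fun Gx iv)))) (is_deriveM_fun fx Fx)) _.
  by rewrite /dH /GRing.scale/=; field.
have [c cb E] := mean_value b0 HdH.
have H0 : H 0 = 0 by rewrite /H w10 w20 !mul0r !mulr0 subr0.
have Hb : H b = 0 by rewrite /H fb !mul0r mulr0 subr0.
have [w20' w21 w22] := w12 c cb; have fc := fn c cb.
have : dH c < 0.
  have h1 : 0 <= rho * w2 c * (df c - f c * (dg c / g c)) ^+ 2.
    by rewrite mulr_ge0 ?sqr_ge0// mulr_ge0.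
  have h2 : 0 <= (w1 c - rho * w2 c) * df c ^+ 2.
    by rewrite mulr_ge0 ?sqr_ge0// subr_ge0.
  have h3 : 0 < (rho * kap * w2 c - lam * w1 c) * f c ^+ 2.
    by rewrite mulr_gt0 ?subr_gt0// lt_def sqr_ge0 sqrf_eq0 fc.
  by rewrite /dH; lra.
move: E; rewrite H0 Hb subrr subr0 => /esym/eqP.
by rewrite mulf_eq0 (gt_eqF b0) orbF => /eqP ->; rewrite ltxx.
Qed.

(** The change of variable [z' = s / 2], [s^2 = 4 z (1 - eps z)] brings the
    hypergeometric equation to the self-adjoint form [(s^d f')' = - lam s^d f]: the
    sphere takes [s = sin], the flat space [s = id]. *)
Lemma hg_sturm d eps lam (r b : R) (z s : R -> R) : 0 <= eps -> eps * r <= 1 ->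
  (0 < d)%N -> s 0 = 0 ->
  (forall x, 0 <= x <= b -> [/\ `|z x| < r, is_derive x 1 z (s x / 2),
     is_derive x 1 s (1 - 2 * eps * z x) & s x ^+ 2 = 4 * (z x * (1 - eps * z x))]) ->
  sturm_solution (fun x => s x ^+ d) (fun x => hg d.+1 eps lam (z x))
    (fun x => hg1 d.+1 eps lam (z x) * (s x / 2)) lam b.
Proof.
move=> eps0 er d0 s0 zs; split=> [|x /zs[zr dz _ _]|x /zs[zr dz ds sE]].
- by rewrite s0 expr0n gtn_eqF.
- by apply: is_derive_comp_fun dz; exact: (is_derive_hg _ (ltn0Sn d) eps0 er).
have dh1 := is_derive_comp_fun (is_derive_hg1 lam (ltn0Sn d) eps0 er zr) dz.
have dsd : is_derive x 1 (fun x => s x ^+ d.+1) (d.+1%:R * s x ^+ d * (1 - 2 * eps * z x)).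
  by have := is_deriveX d.+1 ds; rewrite /= /GRing.scale/= exprfctE.
have -> : (fun t => s t ^+ d * (hg1 d.+1 eps lam (z t) * (s t / 2)))
   = (fun t => 2^-1 * (s t ^+ d.+1 * hg1 d.+1 eps lam (z t))).
  by apply/funext => t; rewrite exprSr; field.
apply: is_derive_eq (is_deriveMl_fun 2^-1 (is_deriveM_fun dsd dh1)) _.
have ode := hg_ode lam (ltn0Sn d) eps0 er zr.
rewrite exprSr.
set F := hg _ _ _ _ in ode *; set F1 := hg1 _ _ _ _ in ode *.
set F2 := hg2 _ _ _ _ in ode *.
have -> : lam * (s x ^+ d * F) = s x ^+ d * (lam * F) by ring.
have -> : lam * F = - (z x * (1 - eps * z x) * F2
    + d.+1%:R / 2 * (1 - 2 * eps * z x) * F1).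
  by apply/eqP; rewrite -addr_eq0 addrC ode.
have -> : z x * (1 - eps * z x) = s x ^+ 2 / 4 by rewrite sE; field.
by field.
Qed.

End Comparison.

(** * Zonal functions on the sphere and radial functions on the ball *)

Section Zonal.
Variable R : realType.
Implicit Types (lam mu kap gamma t x B : R) (d : nat).

Lemma sin_le t : 0 <= t -> sin t <= t.
Proof.
move=> t0; pose f (x : R) := sin x - x.
have df (x : R) : 0 <= x <= t -> is_derive x 1 f (cos x - 1).
  by move=> _; exact: is_deriveB_fun (is_derive_sin x) (is_derive_id x 1).
have := is_derive_nincr df _ (lexx 0) t0 (lexx t).
rewrite /f sin0 subrr subr_le0; apply=> x _.
by rewrite subr_le0 cos_le1.
Qed.

(** Jordan's inequality: [x cos x - sin x] decreases from 0 on [0, pi], so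
    [sin x / x] decreases. *)
Lemma sin_ge_chord gamma t : 0 < gamma -> gamma < pi -> 0 < t -> t <= gamma ->
  sin gamma / gamma * t <= sin t.
Proof.
move=> g0 gpi t0 tg.
pose k (x : R) := x * cos x - sin x.
have dk (x : R) : 0 <= x <= gamma -> is_derive x 1 k (- (x * sin x)).
  move=> _; apply: is_derive_eq (is_deriveB_fun (is_deriveM_fun (is_derive_id x 1)
    (is_derive_cos x)) (is_derive_sin x)) _; ring.
have k0 x : 0 <= x -> x <= gamma -> k x <= 0.
  move=> x0 xg; have -> : 0 = k 0 by rewrite /k mul0r sin0 subrr.
  apply: (is_derive_nincr dk) => // y /andP[y0 yg].
  rewrite oppr_le0 mulr_ge0 ?(ltW y0)// sin_ge0_pi// (ltW y0)/=.
  by rewrite ltW// (lt_trans yg).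
pose f (x : R) := sin x / x.
have df (x : R) : t <= x <= gamma -> is_derive x 1 f (k x / x ^+ 2).
  move=> /andP[tx xg]; have x0 : x != 0 by rewrite gt_eqF// (lt_le_trans t0).
  have iv := @is_deriveV R id x 1 1 x0 (is_derive_id x 1).
  apply: is_derive_eq (is_deriveM_fun (is_derive_sin x) iv) _.
  by rewrite /k /GRing.scale/=; field.
suff : f gamma <= f t by rewrite /f ler_pdivlMr.
apply: (is_derive_nincr df) => // x /andP[tx xg].
rewrite pmulr_lle0 ?invr_gt0 ?exprn_gt0 ?(lt_trans t0)//.
by apply: k0; rewrite ltW// (lt_trans t0).
Qed.

(** This is [sin^2 (t / 2)], the variable in which the equation on the sphere is
    hypergeometric. *)
Definition zonal_coord t : R := (1 - cos t) / 2.

Lemma zonal_coord_ge0 t : 0 <= zonal_coord t.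
Proof. by rewrite divr_ge0 ?subr_ge0 ?cos_le1. Qed.

Lemma zonal_coord_le gamma t : 0 <= t -> t <= gamma -> gamma < pi ->
  zonal_coord t <= zonal_coord gamma.
Proof.
move=> t0 tg gpi; rewrite ler_wpM2r// lerD2l lerN2.
rewrite leNgt; apply/negP; rewrite ltr_cos ?in_itv/= ?t0 ?(le_trans t0 tg) ?ltW//=.
  by rewrite ltNge tg.
exact: le_lt_trans gpi.
Qed.

Lemma zonal_coord_lt1 t : 0 <= t -> t < pi -> zonal_coord t < 1.
Proof.
move=> t0 tpi; rewrite ltr_pdivrMr// mul1r.
have : - 1 < cos t.
  by rewrite -cospi ltr_cos ?in_itv/= ?lexx ?andbT ?t0 ?pi_ge0// ltW.
lra.
Qed.

(** [zonal d lam] is the rotation invariant function of the colatitude which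
    solves [- Laplacian = lam] near the pole of the sphere of dimension [d + 1];
    [flat d kap] is its counterpart for the ball of the same dimension. *)
Definition zonal d lam t := hg d.+1 1 lam (zonal_coord t).
Definition flat d kap t := hg d.+1 0 kap (t ^+ 2 / 4).

Definition zonal1 d lam t := hg1 d.+1 1 lam (zonal_coord t) * (sin t / 2).
Definition flat1 d kap t := hg1 d.+1 0 kap (t ^+ 2 / 4) * (t / 2).

Lemma zonal0 d lam : zonal d lam 0 = 1.
Proof. by rewrite /zonal /zonal_coord cos0 subrr mul0r hg0. Qed.

Lemma zonal_sturm d lam gamma : (0 < d)%N -> gamma < pi ->
  sturm_solution (fun x => sin x ^+ d) (zonal d lam) (zonal1 d lam) lam gamma.
Proof.
move=> d0 gpi; apply: (@hg_sturm _ d 1 lam 1) => // [|x /andP[x0 xg]].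
  exact: sin0.
split.
- by rewrite ger0_norm ?zonal_coord_ge0// zonal_coord_lt1// (le_lt_trans xg).
- have := is_deriveMl_fun 2^-1 (is_deriveB_fun (is_derive_cst (1 : R) x 1) (is_derive_cos x)).
  rewrite (_ : (fun y => _) = zonal_coord); last by apply/funext => y; exact: mulrC.
  by move=> h; apply: is_derive_eq h _; field.
- by apply: is_derive_eq (is_derive_sin x) _; rewrite /zonal_coord; field.
- by rewrite sin2cos2 /zonal_coord; field.
Qed.

Lemma flat_sturm d kap gamma : (0 < d)%N ->
  sturm_solution (fun x => x ^+ d) (flat d kap) (flat1 d kap) kap gamma.
Proof.
move=> d0; apply: (@hg_sturm _ d 0 kap (gamma ^+ 2 / 4 + 1)) => // [|x /andP[x0 xg]].
  by rewrite mul0r.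
split.
- rewrite ger0_norm ?divr_ge0 ?sqr_ge0//.
  have : x ^+ 2 <= gamma ^+ 2 by rewrite lerXn2r// nnegrE// (le_trans x0).
  lra.
- have := is_deriveMl_fun 4^-1 (is_deriveM_fun (is_derive_id x 1) (is_derive_id x 1)).
  rewrite (_ : (fun y => _) = (fun t => t ^+ 2 / 4)); last first.
    by apply/funext => y; rewrite expr2 mulrC.
  by move=> h; apply: is_derive_eq h _; field.
- by apply: is_derive_eq (is_derive_id x 1) _; ring.
- by field.
Qed.

(** At an interior zero of a nonnegative solution the derivative vanishes too. The
    flux [sin^d zonal1] decreases from 0, so it would be 0 up to that zero, and the
    solution would keep its value 1. *)
Lemma zonal_no_touching d lam gamma t : (0 < d)%N -> gamma < pi -> 0 <= lam ->
  (forall x, 0 <= x <= gamma -> 0 <= zonal d lam x) ->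
  0 < t -> t < gamma -> zonal d lam t != 0.
Proof.
move=> d0 gpi lam0 z0 t0 tg; apply/eqP => zt.
have [w0 dz dP] := zonal_sturm lam d0 gpi.
have dz0 : zonal1 d lam t = 0.
  have [||||_ <-] := @derive1_at_min R (zonal d lam) 0 gamma t.
  - by rewrite ltW// (lt_trans t0).
  - move=> x; rewrite in_itv/= => /andP[x0 xg].
    by have [] : is_derive x 1 (zonal d lam) (zonal1 d lam x) by apply: dz; rewrite !ltW.
  - by rewrite in_itv/= t0.
  - by move=> x; rewrite in_itv/= => /andP[x0 xg]; rewrite zt z0// !ltW.
  - have : is_derive t 1 (zonal d lam) (zonal1 d lam t) by apply: dz; rewrite !ltW.
    by case=> _ ->.
have sin_pos x : 0 < x -> x < gamma -> 0 < sin x.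
  by move=> x0 xg; rewrite sin_gt0_pi// x0 (lt_trans xg).
pose P x := sin x ^+ d * zonal1 d lam x.
have P0 x : 0 <= x -> x <= t -> P x = 0.
  move=> x0 xt; have mono : forall x y, 0 <= x -> x <= y -> y <= gamma -> P y <= P x.
    apply: (is_derive_nincr dP) => y /andP[y0 yg].
    have zy : 0 <= zonal d lam y by apply: z0; rewrite !ltW.
    by rewrite oppr_le0 !mulr_ge0// exprn_ge0// ltW// sin_pos.
  apply/eqP; rewrite eq_le; apply/andP; split.
    have <- : P 0 = 0 by rewrite /P w0 mul0r.
    by apply: mono => //; rewrite (le_trans xt) // ltW.
  have <- : P t = 0 by rewrite /P dz0 mulr0.
  by apply: mono => //; rewrite ltW.
have [|c /andP[c0 ct] E] := @mean_value _ (zonal d lam) (zonal1 d lam) 0 t t0.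
  by move=> x /andP[x0 xt]; apply: dz; rewrite x0 (le_trans xt)// ltW.
have /eqP := P0 c (ltW c0) (ltW ct).
rewrite mulf_eq0 expf_eq0 (gt_eqF (sin_pos c c0 (lt_trans ct tg))) andbF/= => /eqP z1.
by move: E; rewrite z1 mul0r zt zonal0; lra.
Qed.

End Zonal.

(** * The first zonal eigenvalue *)

Section FirstZero.
Variable R : realType.
Implicit Types (lam mu kap gamma t x B : R) (d : nat).

Lemma zonal_eigen0 d t : zonal d 0 t = 1 :> R.
Proof.
have c0 k : hgcoef d.+1 1 0 k.+1 = 0 :> R.
  elim: k => [|k IH]; last by rewrite -[LHS]/(hgcoef d.+1 1 0 k.+1 * _) IH mul0r.
  by rewrite /= mul0r mulr0 subrr mul0r mulr0.
apply: lim_near_cst => //; near=> k; have k0 : (0 < k)%N by near: k; exists 1%N.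
rewrite -(prednK k0) /pseries /series /= big_nat_recl//= expr0 mulr1.
by rewrite big1 ?addr0// => i _; rewrite -[hgcoef _ _ _ _ * _]/(hgcoef d.+1 1 0 i.+1) c0 mul0r.
Unshelve. all: by end_near. Qed.

Lemma zonal_lipschitz d gamma mu : 0 <= gamma -> gamma < pi -> 0 <= mu ->
  exists2 M : R, 0 < M & forall lam1 lam2 t, 0 <= lam1 <= mu -> 0 <= lam2 <= mu ->
    0 <= t <= gamma -> `|zonal d lam1 t - zonal d lam2 t| <= `|lam1 - lam2| * M.
Proof.
move=> g0 gpi mu0; pose M := hg d.+1 1 (- (mu + 1)) (zonal_coord gamma).
exists (`|M| + 1) => [|lam1 lam2 t /andP[l10 l1] /andP[l20 l2] /andP[t0 tg]].
  by rewrite ltr_wpDl.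
have h : `|zonal d lam1 t - zonal d lam2 t| <= `|lam1 - lam2| * M.
  apply: (@hg_lipschitz _ _ _ _ _ _ _ mu _ _ 1) => //.
  - exact: zonal_coord_lt1.
  - by rewrite ger0_norm.
  - by rewrite ger0_norm.
  - by rewrite ger0_norm ?zonal_coord_ge0// zonal_coord_le.
by rewrite (le_trans h)// ler_wpM2l// (le_trans (ler_norm _))// lerDl ler01.
Qed.

(** The first Dirichlet eigenvalue of the cap among rotation invariant functions,
    found as the last [lam] up to which [zonal d lam] stays positive on
    [0, gamma]. *)
Lemma exists_zonal_first_zero d gamma mu : (0 < d)%N -> 0 < gamma -> gamma < pi ->
  0 <= mu -> ~ (forall t, 0 <= t <= gamma -> 0 < zonal d mu t) ->
  exists2 lam, 0 <= lam <= mu &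
    zonal d lam gamma = 0 /\ forall t, 0 <= t < gamma -> 0 < zonal d lam t.
Proof.
move=> d0 g0 gpi mu0 Nmu; have [M M0 lip] := zonal_lipschitz d (ltW g0) gpi mu0.
pose S := [set lam | 0 <= lam <= mu /\ forall t, 0 <= t <= gamma -> 0 < zonal d lam t].
have S0 : S 0 by split=> [|t _]; rewrite ?lexx ?mu0// zonal_eigen0.
have Sub : has_ubound S by exists mu => l [] /andP[].
have supS : has_sup S by split; [exists 0|].
pose ls := sup S.
have ls0 : 0 <= ls by apply: ub_le_sup.
have lsmu : ls <= mu by apply: ge_sup; [exists 0|move=> l [] /andP[]].
have lsI : 0 <= ls <= mu by rewrite ls0.
have zge0 t : 0 <= t <= gamma -> 0 <= zonal d ls t.
  move=> tg; rewrite leNgt; apply/negP => zt.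
  have e0 : 0 < - zonal d ls t / M by rewrite divr_gt0 ?oppr_gt0.
  have [l Sl ll] := sup_adherent e0 supS.
  have [lmu lpos] := Sl; have lls : l <= ls by apply: ub_le_sup.
  have := lip l ls t lmu lsI tg; have := lpos t tg.
  rewrite -/ls in ll; rewrite (ler0_norm (_ : l - ls <= 0)) ?subr_le0// opprB.
  have : (ls - l) * M < - zonal d ls t by rewrite -ltr_pdivlMr// ; lra.
  by move=> h1 h2 /ler_normlP[]; lra.
have zero : exists2 t, 0 <= t <= gamma & zonal d ls t = 0.
  apply: contrapT => Nz.
  have zpos t : 0 <= t <= gamma -> 0 < zonal d ls t.
    move=> tg; rewrite lt_def zge0// andbT; apply/eqP => zt.
    by apply: Nz; exists t.
  have [_ dz _] := zonal_sturm ls d0 gpi.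
  have [t0 + tmin] := EVT_min (ltW g0) (within_continuous_is_derive dz).
  rewrite in_itv/= => tg0; have a0 := zpos t0 tg0; set a := zonal d ls t0 in a0 tmin.
  pose l := Num.min mu (ls + a / (2 * M)).
  have e0 : 0 < a / (2 * M) by rewrite divr_gt0 ?mulr_gt0.
  have lle : ls <= l by rewrite le_min lsmu lerDl ltW.
  have l2 : l <= ls + a / (2 * M) by rewrite ge_min lexx orbT.
  have lmu : 0 <= l <= mu by rewrite (le_trans ls0 lle) ge_min lexx.
  have Sl : S l.
    split=> // t tg; have := lip l ls t lmu lsI tg.
    rewrite (ger0_norm (_ : 0 <= l - ls)) ?subr_ge0//.
    have : (l - ls) * M <= a / 2.
      apply: (@le_trans _ _ (a / (2 * M) * M)); first by rewrite ler_wpM2r ?(ltW M0)//; lra.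
      by rewrite invfM mulrA divfK// gt_eqF.
    have : a <= zonal d ls t by apply: tmin; rewrite in_itv.
    by move=> h1 h2 /ler_normlP[]; lra.
  have lls : l <= ls by apply: ub_le_sup.
  have lE : l = mu.
    have : l = mu \/ l = ls + a / (2 * M) by rewrite /l; case: leP => _; [left|right].
    by case=> // lE; move: lls e0; rewrite lE; lra.
  by apply: Nmu; rewrite -lE; case: Sl.
case: zero => t /andP[t0 tg] zt.
have tn0 : t != 0 by apply/eqP => t00; move: zt; rewrite t00 zonal0 => /eqP; rewrite oner_eq0.
have tpos : 0 < t by rewrite lt_def tn0.
have zlt x : 0 <= x < gamma -> 0 < zonal d ls x.
  move=> /andP[x0 xg]; rewrite lt_def zge0 ?x0 ?(ltW xg)// andbT.
  have [->|xn0] := eqVneq x 0; first by rewrite zonal0 oner_neq0.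
  by apply: (@zonal_no_touching _ _ _ gamma) => //; rewrite lt_def xn0.
exists ls => //; split=> //.
move: tg; rewrite le_eqVlt => /predU1P[<-//|tg].
by have := zlt t; rewrite t0 tg zt ltxx => /(_ isT).
Qed.

Section Bounds.
Variables (d : nat) (gamma B : R).
Hypotheses (d0 : (0 < d)%N) (g0 : 0 < gamma) (gpi : gamma < pi) (B0 : 0 < B).
Hypotheses (BJ : hg d.+1 0 1 (B ^+ 2 / 4) = 0)
  (Bpos : forall x, 0 <= x -> x < B -> 0 < hg d.+1 0 1 (x ^+ 2 / 4)).

Let rho := (sin gamma / gamma) ^+ d.

Let sg0 : 0 < sin gamma. Proof. by rewrite sin_gt0_pi ?g0. Qed.

Let rho0 : 0 < rho. Proof. by rewrite exprn_gt0// divr_gt0. Qed.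

Let weights x : 0 < x <= gamma -> 0 < x ^+ d /\ rho * x ^+ d <= sin x ^+ d <= x ^+ d.
Proof.
move=> /andP[x0 xg]; split; first by rewrite exprn_gt0.
have c0 : 0 <= sin gamma / gamma * x by rewrite mulr_ge0 ?divr_ge0// ltW.
have h := sin_ge_chord g0 gpi x0 xg.
rewrite /rho -exprMn; apply/andP; split; rewrite lerXn2r ?nnegrE//.
- exact: le_trans h.
- exact: le_trans h.
- exact: ltW.
- exact: sin_le (ltW x0).
Qed.

Let flatE kap t : flat d kap t = hg d.+1 0 1 (kap * (t ^+ 2 / 4)).
Proof. exact: hg_scale. Qed.

(** If the zonal solution were positive up to [gamma], it would bound from below the
    Rayleigh quotient of the flat eigenfunction, whose mass shrinks at most by the
    factor [rho] on the sphere while its energy does not grow. *)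
Lemma zonal_vanishes mu : (gamma / sin gamma) ^+ d * (B / gamma) ^+ 2 < mu ->
  ~ (forall t, 0 <= t <= gamma -> 0 < zonal d mu t).
Proof.
move=> hmu; pose kap := (B / gamma) ^+ 2.
have gn0 : gamma != 0 by rewrite gt_eqF.
have kmu : kap < mu * rho.
  rewrite -ltr_pdivrMr// mulrC /rho -exprVn invf_div; exact: hmu.
apply: (sturm_comparison g0 ler01 (flat_sturm kap gamma d0) (zonal_sturm mu d0 gpi)).
- move=> x /andP[x0 xg]; have [xd /andP[rx sx]] : 0 < x ^+ d /\ rho * x ^+ d <= sin x ^+ d <= x ^+ d.
    by apply: weights; rewrite x0 ltW.
  have s0 : 0 <= sin x ^+ d by apply: le_trans rx; rewrite mulr_ge0 ?ltW.
  split=> //; first by rewrite mul1r.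
  rewrite mul1r (@lt_le_trans _ _ (mu * rho * x ^+ d))//; first by rewrite ltr_pM2r.
  rewrite -mulrA ler_wpM2l//.
  by rewrite -(pmulr_lge0 _ rho0) ltW// (le_lt_trans _ kmu)// sqr_ge0.
- move=> x /andP[x0 xg]; rewrite gt_eqF// flatE.
  have -> : kap * (x ^+ 2 / 4) = (B * (x / gamma)) ^+ 2 / 4 by rewrite /kap; field.
  apply: Bpos; first by rewrite mulr_ge0 ?divr_ge0 ?ltW.
  by rewrite gtr_pMr// ltr_pdivrMr// mul1r.
- rewrite flatE; have -> : kap * (gamma ^+ 2 / 4) = B ^+ 2 / 4 by rewrite /kap; field.
  exact: BJ.
Qed.

(** Otherwise some [l <= lam] is a zonal eigenvalue, and its eigenfunction has on the
    ball a Rayleigh quotient at most [l / rho]; this is too small. *)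
Lemma zonal_pos lam : 0 <= lam -> lam < rho * (B / gamma) ^+ 2 ->
  forall t, 0 <= t <= gamma -> 0 < zonal d lam t.
Proof.
move=> lam0 hlam.
have gn0 : gamma != 0 by rewrite gt_eqF.
(* a radius below B leaves the flat solution positive up to the boundary *)
have [b bB lb] : exists2 b, 0 <= b < B & lam < rho * (b / gamma) ^+ 2.
  have lr0 : 0 <= lam / rho by rewrite divr_ge0 ?(ltW rho0).
  pose b0 := gamma * Num.sqrt (lam / rho).
  have b0B : b0 < B.
    suff : Num.sqrt (lam / rho) < B / gamma by rewrite ltr_pdivlMr// mulrC.
    have Bg : 0 <= B / gamma by rewrite divr_ge0 ?ltW.
    rewrite -(ger0_norm Bg) -sqrtr_sqr ltr_sqrt ?exprn_gt0 ?divr_gt0//.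
    by rewrite ltr_pdivrMr// mulrC.
  have b00 : 0 <= b0 by rewrite mulr_ge0 ?sqrtr_ge0 ?ltW.
  exists ((b0 + B) / 2); first by apply/andP; split; lra.
  have : Num.sqrt (lam / rho) < (b0 + B) / 2 / gamma.
    by rewrite ltr_pdivlMr// mulrC -/b0; lra.
  rewrite -(ltr_pXn2r (ltn0Sn 1)) ?nnegrE ?sqrtr_ge0 ?divr_ge0 ?(ltW g0)//; last by lra.
  by rewrite sqr_sqrtr// ltr_pdivrMr// mulrC.
move: bB => /andP[b0 bB]; pose kap := (b / gamma) ^+ 2.
apply: contrapT => Npos.
have [l /andP[l0 llam] [zg zpos]] := exists_zonal_first_zero d0 g0 gpi lam0 Npos.
apply: (sturm_comparison g0 (ltW rho0) (zonal_sturm l d0 gpi) (flat_sturm kap gamma d0)).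
- move=> x /andP[x0 xg].
  have [xd /andP[rx sx]] : 0 < x ^+ d /\ rho * x ^+ d <= sin x ^+ d <= x ^+ d.
    by apply: weights; rewrite x0 ltW.
  split=> //; first exact: ltW.
  apply: (@le_lt_trans _ _ (lam * x ^+ d)); last by rewrite ltr_pM2r.
  apply: ler_pM => //.
  by apply: le_trans rx; rewrite mulr_ge0 ?ltW.
- by move=> x /andP[x0 xg]; rewrite gt_eqF// zpos// (ltW x0).
- exact: zg.
- move=> x /andP[x0 xg]; rewrite flatE.
  have -> : kap * (x ^+ 2 / 4) = (b * (x / gamma)) ^+ 2 / 4 by rewrite /kap; field.
  apply: Bpos; first by rewrite mulr_ge0 ?divr_ge0 ?(ltW g0).
  apply: le_lt_trans bB; rewrite ler_piMr// ler_pdivrMr// mul1r//.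
Qed.

End Bounds.
End FirstZero.

(** * The Euclidean norm and the radial retraction *)

Section EuclideanNorm.
Variables (R : realType) (n : nat).
Implicit Types (x y : 'rV[R]_n.+1) (i j : 'I_n.+1) (gamma c : R).

Lemma enorm_ge0 x : 0 <= enorm x. Proof. exact: sqrtr_ge0. Qed.

Lemma sumsq_ge0 x : 0 <= \sum_i x ord0 i ^+ 2.
Proof. by apply: sumr_ge0 => i _; exact: sqr_ge0. Qed.

Lemma enorm_sqr x : enorm x ^+ 2 = \sum_i x ord0 i ^+ 2.
Proof. by rewrite sqr_sqrtr// sumsq_ge0. Qed.

Lemma enorm_eq0 x : (enorm x == 0) = (x == 0).
Proof.
apply/idP/eqP => [|->]; last first.
  by rewrite /enorm big1 ?sqrtr0// => i _; rewrite mxE expr0n.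
rewrite -sqrf_eq0 enorm_sqr psumr_eq0 => [/allP h|i _]; last exact: sqr_ge0.
apply/rowP => i; rewrite mxE; apply/eqP; rewrite -sqrf_eq0.
by apply: h; rewrite mem_index_enum.
Qed.

Lemma enorm_gt0 x : (0 < enorm x) = (x != 0).
Proof. by rewrite lt_def enorm_ge0 andbT enorm_eq0. Qed.

Lemma normr_coord_le x i : `|x ord0 i| <= enorm x.
Proof.
rewrite -sqrtr_sqr ler_sqrt ?sumsq_ge0// (bigD1 i)//= lerDl.
by apply: sumr_ge0 => j _; exact: sqr_ge0.
Qed.

Lemma enormZ c x : 0 <= c -> enorm (c *: x) = c * enorm x.
Proof.
move=> c0; rewrite /enorm -[in RHS](ger0_norm c0) -[in RHS]sqrtr_sqr -sqrtrM ?sqr_ge0//.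
by rewrite mulr_sumr; congr Num.sqrt; apply: eq_bigr => i _; rewrite mxE exprMn.
Qed.

Lemma enorm_proj x : x != 0 -> enorm (sph_proj x) = 1.
Proof.
by rewrite -enorm_gt0 => x0; rewrite enormZ ?invr_ge0 ?ltW// mulVf ?gt_eqF.
Qed.

Lemma sph_proj_id x : enorm x = 1 -> sph_proj x = x.
Proof. by move=> x1; rewrite /sph_proj x1 invr1 scale1r. Qed.

Lemma sph_projZ c x : 0 < c -> sph_proj (c *: x) = sph_proj x.
Proof.
move=> c0; rewrite /sph_proj enormZ ?ltW// scalerA.
by rewrite invfM mulrAC mulVf ?mul1r// gt_eqF.
Qed.

Lemma continuous_coord i : continuous (fun x : 'rV[R]_n.+1 => x ord0 i).
Proof. exact: coord_continuous. Qed.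

Lemma continuous_enorm : continuous (@enorm R n).
Proof.
move=> x; have Fx : Filter (nbhs (x : 'rV[R]_n.+1)) := nbhs_filter x.
apply: (@continuous_comp _ _ _ (fun x => \sum_i x ord0 i ^+ 2) Num.sqrt).
  rewrite /continuous_at; apply: cvg_big => [|i _]; first exact: add_continuous.
  apply: (@continuous_comp _ _ _ (fun x : 'rV[R]_n.+1 => x ord0 i) (fun t => t ^+ 2)).
    exact: continuous_coord.
  exact: exprn_continuous.
exact: sqrt_continuous.
Qed.

Lemma continuous_rnorm x : x != 0 -> {for x, continuous (fun y => (enorm y)^-1)}.
Proof.
move=> x0; have Fx : Filter (nbhs (x : 'rV[R]_n.+1)) := nbhs_filter x.
by apply: cvgV; [rewrite enorm_eq0|exact: continuous_enorm].
Qed.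

Lemma is_derive_coord i j x :
  is_derive x (basis_vec R i) (fun y => y ord0 j) ((i == j)%:R).
Proof.
apply/is_derive_line.
have E : (fun h : R => (h *: basis_vec R i + x) ord0 j) =
   (fun h => (i == j)%:R * h + x ord0 j).
  by apply/funext => h; rewrite !mxE/= eq_sym mulrC.
rewrite E; apply: is_derive_eq (is_deriveD_fun
  (is_deriveMl_fun (i == j)%:R (is_derive_id (0 : R) 1)) (is_derive_cst (x ord0 j) _ _)) _.
by rewrite mulr1 addr0.
Qed.

Lemma is_derive_enorm i x : x != 0 ->
  is_derive x (basis_vec R i) (@enorm R n) (x ord0 i * (enorm x)^-1).
Proof.
move=> x0; have e0 : 0 < enorm x by rewrite enorm_gt0.
have s0 : 0 < \sum_j x ord0 j ^+ 2 by rewrite -sqrtr_gt0.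
have dsq : is_derive x (basis_vec R i) (fun y : 'rV[R]_n.+1 => \sum_j y ord0 j ^+ 2)
    (2 * x ord0 i).
  have := @is_derive_sum _ _ _ _ (fun j (y : 'rV[R]_n.+1) => y ord0 j ^+ 2) x
    (basis_vec R i) (fun j => 2 * ((i == j)%:R * x ord0 j)) _.
  rewrite (_ : \sum_j (fun y : 'rV[R]_n.+1 => y ord0 j ^+ 2) =
      (fun y => \sum_j y ord0 j ^+ 2)); last by apply/funext => y; rewrite fct_sumE.
  have -> : \sum_j 2 * ((i == j)%:R * x ord0 j) = 2 * x ord0 i.
    rewrite (bigD1 i)//= eqxx mul1r big1 ?addr0// => j ji.
    by rewrite eq_sym (negPf ji) mul0r mulr0.
  apply=> j; apply: is_derive_eq (is_deriveM_fun (is_derive_coord i j x)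
    (is_derive_coord i j x)) _; ring.
apply: is_derive_eq (is_derive_comp_fun (is_derive1_sqrt s0) dsq) _.
by rewrite -/(enorm x); field; exact: lt0r_neq0.
Qed.

Lemma is_derive_rnorm i x : x != 0 ->
  is_derive x (basis_vec R i) (fun y => (enorm y)^-1) (- (x ord0 i * (enorm x)^-1 ^+ 3)).
Proof.
move=> x0; have e0 : 0 < enorm x by rewrite enorm_gt0.
have dV := @is_deriveV R id (enorm x) 1 1 (lt0r_neq0 e0) (is_derive_id _ _).
apply: is_derive_eq (is_derive_comp_fun dV (is_derive_enorm i x0)) _.
by rewrite /GRing.scale/=; field; exact: lt0r_neq0.
Qed.

End EuclideanNorm.

(** * The Laplace-Beltrami operator on the cone *)

Section ConeCalculus.
Variables (R : realType) (n : nat).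
Implicit Types (x y : 'rV[R]_n.+1) (i j : 'I_n.+1) (gamma lam : R).

Let e i := basis_vec R i.

Lemma cone_open gamma : open (cone n gamma : set 'rV[R]_n.+1).
Proof.
rewrite (_ : cone n gamma = (fun x => enorm x) @^-1` [set t | 0 < t] `&`
    (fun x => x ord0 ord_max - enorm x * cos gamma) @^-1` [set t | 0 < t]); last first.
  by apply/seteqP; split=> x /=; rewrite enorm_gt0 subr_gt0.
apply: openI; apply: open_comp; try exact: open_gt.
  by move=> x _; exact: continuous_enorm.
move=> x _; have Fx : Filter (nbhs (x : 'rV[R]_n.+1)) := nbhs_filter x.
apply: cvgB; first exact: continuous_coord.
by apply: cvgMr_tmp; exact: continuous_enorm.
Qed.

Lemma cone_near gamma x : cone n gamma x -> \near x, cone n gamma x.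
Proof. by move=> cx; apply: open_nbhs_nbhs; split=> //; exact: cone_open. Qed.

Lemma cone_proj gamma x : cone n gamma x -> cap n gamma (sph_proj x).
Proof.
move=> [x0 hx]; have e0 : 0 < enorm x by rewrite enorm_gt0.
have e1 := enorm_proj x0; split; last exact: e1.
split; first by rewrite -enorm_gt0 e1.
by rewrite e1 mul1r /sph_proj mxE mulrC ltr_pdivlMr// mulrC.
Qed.

Lemma C1_on_congr (A : set 'rV[R]_n.+1) (f g : 'rV[R]_n.+1 -> R) : open A ->
  (forall x, A x -> f x = g x) -> C1_on A f -> C1_on A g.
Proof.
move=> oA fg Cf i x Ax; have [df cf] := Cf i x Ax.
have nA y : A y -> \near y, f y = g y.
  move=> Ay; have Fy : Filter (nbhs (y : 'rV[R]_n.+1)) := nbhs_filter y.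
  by apply: filterS (open_nbhs_nbhs (conj oA Ay)) => z; exact: fg.
split; first by apply: near_eq_derivable df; exact: nA.
rewrite /prop_for /continuous_at -(near_eq_derive _ (nA x Ax)).
move: cf; rewrite /prop_for /continuous_at => cf.
have Fx : Filter (nbhs (x : 'rV[R]_n.+1)) := nbhs_filter x.
apply: cvg_trans cf; apply: near_eq_cvg.
apply: filterS (open_nbhs_nbhs (conj oA Ax)) => y Ay.
exact/near_eq_derive/nA.
Qed.

Lemma C1_onP (A : set 'rV[R]_n.+1) (f : 'rV[R]_n.+1 -> R)
    (df : 'I_n.+1 -> 'rV[R]_n.+1 -> R) : open A ->
  (forall i x, A x -> is_derive x (e i) f (df i x)) ->
  (forall i x, A x -> {for x, continuous (df i)}) -> C1_on A f.
Proof.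
move=> oA dfE cdf i x Ax; have [dx Ex] := dfE i x Ax; split=> //.
rewrite /prop_for /continuous_at Ex.
have := cdf i x Ax; rewrite /prop_for /continuous_at => cf.
have Fx : Filter (nbhs (x : 'rV[R]_n.+1)) := nbhs_filter x.
apply: cvg_trans cf; apply: near_eq_cvg.
apply: filterS (open_nbhs_nbhs (conj oA Ax)) => y Ay.
by have [_ ->] := dfE i y Ay.
Qed.

(** The derivatives of a function that is constant along rays are homogeneous of
    degree [-1]; this is what trades the projections in the definition of the
    Laplace-Beltrami operator for Euclidean derivatives on the cone. *)
Lemma derive_proj_homogeneous (f : 'rV[R]_n.+1 -> R) i x c : 0 < c ->
  derivable (f \o @sph_proj R n) x (e i) ->
  'D_(e i) (f \o @sph_proj R n) (c *: x) = c^-1 * 'D_(e i) (f \o @sph_proj R n) x.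
Proof.
move=> c0 /derivableP /is_derive_line d.
suff : is_derive (c *: x) (e i) (f \o @sph_proj R n)
    ('D_(e i) (f \o @sph_proj R n) x * c^-1) by case=> _ ->; rewrite mulrC.
apply/is_derive_line.
rewrite (_ : (fun h => _) = (fun h : R =>
    (fun k : R => (f \o @sph_proj R n) (k *: e i + x)) (c^-1 * h))).
  apply: (@is_derive_comp_fun _ _ (fun k : R => (f \o @sph_proj R n) (k *: e i + x))
    (fun h : R => c^-1 * h)); first by rewrite mulr0; exact: d.
  by apply: is_derive_eq (is_deriveMl_fun c^-1 (is_derive_id (0 : R) 1)) _; rewrite mulr1.
apply/funext => h /=; congr f.
rewrite -[in RHS](sph_projZ _ c0) scalerDr scalerA mulrA divff ?mul1r//.
by rewrite gt_eqF.
Qed.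

(** Differentiate [|y| D_i F (y)], where [F] is the extension of [f] constant along
    rays: at a point [x] of the sphere the norm contributes [x_i D_i F (x)]. *)
Lemma laplace_beltramiE (f : 'rV[R]_n.+1 -> R) gamma x :
  cap_C2 gamma f -> cap n gamma x ->
  laplace_beltrami f x = \sum_i (x ord0 i * 'D_(e i) (f \o @sph_proj R n) x +
    'D_(e i) ('D_(e i) (f \o @sph_proj R n)) x).
Proof.
move=> [C1 C2] [cx x1]; pose F := f \o @sph_proj R n.
have x0 : x != 0 by case: cx.
rewrite /laplace_beltrami /sph_div; apply: eq_bigr => i _.
have -> : sph_deriv i (fun y => sph_grad f y ord0 i) x =
    'D_(e i) (fun y => enorm y * 'D_(e i) F y) x.
  have Fx : Filter (nbhs (x : 'rV[R]_n.+1)) := nbhs_filter x.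
  apply: near_eq_derive; apply: filterS (cone_near cx) => y cy.
  have y0 : 0 < enorm y by rewrite enorm_gt0; case: cy.
  rewrite /= /sph_grad mxE /sph_deriv derive_proj_homogeneous ?invr_gt0//.
    by rewrite invrK.
  by have [] := C1 i y cy.
have [/derivableP d2 _] := C2 i i x cx.
by have [_ ->] := is_deriveM_fun (is_derive_enorm i x0) d2; rewrite x1 invr1 mulr1 mul1r.
Qed.

End ConeCalculus.

(** * Zonal functions as functions on the cap *)

Section ZonalOnCone.
Variables (R : realType) (n : nat) (lam gamma : R).
Hypothesis n0 : (0 < n)%N.
Implicit Types (x y : 'rV[R]_n.+1) (i j : 'I_n.+1).

Let e i := basis_vec R i.
Let o : 'I_n.+1 := ord_max.
Let q x := (enorm x)^-1.

Definition zonal_fun (x : 'rV[R]_n.+1) : R := hg n 1 lam ((1 - x ord0 ord_max) / 2).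

(* [tau] is the cosine of the colatitude; the algebraic expressions are its partial
   derivatives of orders one and two, in terms of the inverse norm [q] *)
Let tau x := x ord0 o * q x.
Let dtau i x := (i == o)%:R * q x - x ord0 o * (x ord0 i * q x ^+ 3).
Let ddtau j i x := - ((i == o)%:R * (x ord0 j * q x ^+ 3))
  - ((j == o)%:R * (x ord0 i * q x ^+ 3)
     + x ord0 o * ((j == i)%:R * q x ^+ 3 - 3 * (x ord0 i * (x ord0 j * q x ^+ 5)))).

Let z x := (1 - tau x) / 2.
Let U x := hg n 1 lam (z x).
Let U1 i x := hg1 n 1 lam (z x) * (- dtau i x / 2).
Let U2 j i x := hg2 n 1 lam (z x) * (- dtau j x / 2) * (- dtau i x / 2)
  + hg1 n 1 lam (z x) * (- ddtau j i x / 2).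

Let zonal_funE : zonal_fun \o @sph_proj R n = U.
Proof. by apply/funext => x; rewrite /= /zonal_fun /sph_proj mxE [_ * x _ _]mulrC. Qed.

Let z_lt1 x : cone n gamma x -> `|z x| < 1.
Proof.
move=> [x0 hx]; have e0 : 0 < enorm x by rewrite enorm_gt0.
have tau1 : tau x <= 1.
  by rewrite ler_pdivrMr// mul1r (le_trans (ler_norm _))// normr_coord_le.
have : cos gamma < tau x by rewrite ltr_pdivlMr// mulrC.
have := @cos_geN1 R gamma.
by rewrite ger0_norm /z; lra.
Qed.

Let dq i x : x != 0 -> is_derive x (e i) q (- (x ord0 i * q x ^+ 3)).
Proof. exact: is_derive_rnorm. Qed.

Let dtauE i x : x != 0 -> is_derive x (e i) tau (dtau i x).
Proof.
move=> x0; apply: is_derive_eq (is_deriveM_fun (is_derive_coord i o x) (dq i x0)) _.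
by rewrite mulrN.
Qed.

Let ddtauE j i x : x != 0 -> is_derive x (e j) (dtau i) (ddtau j i x).
Proof.
move=> x0; have dqx := dq j x0.
have dq3 : is_derive x (e j) (fun y => q y ^+ 3) (- (3 * (x ord0 j * q x ^+ 5))).
  by apply: is_derive_eq (is_deriveM_fun dqx (is_deriveM_fun dqx dqx)) _; ring.
apply: is_derive_eq (is_deriveB_fun (is_deriveMl_fun (i == o)%:R dqx)
  (is_deriveM_fun (is_derive_coord j o x)
    (is_deriveM_fun (is_derive_coord j i x) dq3))) _.
by rewrite /ddtau; ring.
Qed.

Let dz i x : x != 0 -> is_derive x (e i) z (- dtau i x / 2).
Proof.
move=> x0; have := is_deriveMl_fun 2^-1 (is_deriveB_fun
  (is_derive_cst (1 : R) x (e i)) (dtauE i x0)).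
rewrite (_ : (fun y => _) = z); last by apply/funext => y; exact: mulrC.
by move=> h; apply: is_derive_eq h _; ring.
Qed.

Let dU i x : cone n gamma x -> is_derive x (e i) U (U1 i x).
Proof.
move=> cx; apply: is_derive_comp_fun; last by apply: dz; case: cx.
by apply: (@is_derive_hg _ n 1 lam 1); rewrite ?mulr1// z_lt1.
Qed.

Let dU1 j i x : cone n gamma x -> is_derive x (e j) (U1 i) (U2 j i x).
Proof.
move=> cx; have x0 : x != 0 by case: cx.
have dh : is_derive (z x) 1 (hg1 n 1 lam) (hg2 n 1 lam (z x)).
  by apply: (@is_derive_hg1 _ n 1 lam 1); rewrite ?mulr1// z_lt1.
have dm := is_derive_comp_fun dh (dz j x0).
have E : U1 i = (fun y => - 2^-1 * (hg1 n 1 lam (z y) * dtau i y)).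
  by apply/funext => y; rewrite /U1; ring.
rewrite E; apply: is_derive_eq (is_deriveMl_fun (- 2^-1) (is_deriveM_fun dm (ddtauE j i x0))) _.
by rewrite /U2; ring.
Qed.

Let cq x : x != 0 -> {for x, continuous q}.
Proof. exact: continuous_rnorm. Qed.

Let cdtau i x : x != 0 -> {for x, continuous (dtau i)}.
Proof.
move=> x0; have Fx : Filter (nbhs (x : 'rV[R]_n.+1)) := nbhs_filter x.
apply: cvgB; first by apply: cvgMl_tmp; exact: cq.
apply: cvgM; first exact: continuous_coord.
apply: cvgM; first exact: continuous_coord.
by apply: (@continuous_comp _ _ _ q (fun t => t ^+ 3)); [exact: cq|exact: exprn_continuous].
Qed.

Let cddtau j i x : x != 0 -> {for x, continuous (ddtau j i)}.
Proof.
move=> x0; have Fx : Filter (nbhs (x : 'rV[R]_n.+1)) := nbhs_filter x.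
have cqk k : {for x, continuous (fun y => q y ^+ k)}.
  by apply: (@continuous_comp _ _ _ q (fun t => t ^+ k)); [exact: cq|exact: exprn_continuous].
apply: cvgB.
  apply: cvgN; apply: cvgMl_tmp; apply: cvgM; [exact: continuous_coord|exact: cqk].
apply: cvgD.
  by apply: cvgMl_tmp; apply: cvgM; [exact: continuous_coord|exact: cqk].
apply: cvgM; first exact: continuous_coord.
apply: cvgB; first by apply: cvgMl_tmp; exact: cqk.
apply: cvgMl_tmp; apply: cvgM; first exact: continuous_coord.
by apply: cvgM; [exact: continuous_coord|exact: cqk].
Qed.

Let cz x : x != 0 -> {for x, continuous z}.
Proof.
move=> x0; have Fx : Filter (nbhs (x : 'rV[R]_n.+1)) := nbhs_filter x.
apply: cvgMr_tmp; apply: cvgB; first exact: cvg_cst.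
by apply: cvgM; [exact: continuous_coord|exact: cq].
Qed.

Let ch1 x : cone n gamma x -> {for x, continuous (fun y => hg1 n 1 lam (z y))}.
Proof.
move=> cx; apply: (@continuous_comp _ _ _ z (hg1 n 1 lam)); first by apply: cz; case: cx.
apply: is_derive_continuous.
by apply: (@is_derive_hg1 _ n 1 lam 1); rewrite ?mulr1// z_lt1.
Qed.

Let ch2 x : cone n gamma x -> {for x, continuous (fun y => hg2 n 1 lam (z y))}.
Proof.
move=> cx; apply: (@continuous_comp _ _ _ z (hg2 n 1 lam)); first by apply: cz; case: cx.
by apply: (@continuous_hg2 _ n 1 lam 1); rewrite ?mulr1// z_lt1.
Qed.

Let cU1 i x : cone n gamma x -> {for x, continuous (U1 i)}.
Proof.
move=> cx; have Fx : Filter (nbhs (x : 'rV[R]_n.+1)) := nbhs_filter x.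
apply: cvgM; first exact: ch1.
by apply: cvgMr_tmp; apply: cvgN; apply: cdtau; case: cx.
Qed.

Let cU2 j i x : cone n gamma x -> {for x, continuous (U2 j i)}.
Proof.
move=> cx; have Fx : Filter (nbhs (x : 'rV[R]_n.+1)) := nbhs_filter x.
have x0 : x != 0 by case: cx.
apply: cvgD.
  apply: cvgM; last by apply: cvgMr_tmp; apply: cvgN; exact: cdtau.
  apply: cvgM; first exact: ch2.
  by apply: cvgMr_tmp; apply: cvgN; exact: cdtau.
apply: cvgM; first exact: ch1.
by apply: cvgMr_tmp; apply: cvgN; exact: cddtau.
Qed.

Lemma zonal_fun_C2 : cap_C2 gamma zonal_fun.
Proof.
rewrite /cap_C2 zonal_funE; split.
  exact: (C1_onP (@cone_open R n gamma) dU cU1).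
move=> i; apply: (C1_on_congr (@cone_open R n gamma) (f := U1 i)).
  by move=> x cx; have [_ ->] := dU i cx.
apply: (C1_onP (@cone_open R n gamma) (df := fun j => U2 j i)).
  by move=> j x; exact: dU1.
by move=> j x; exact: cU2.
Qed.

Lemma zonal_fun_eigen x : cap n gamma x ->
  - laplace_beltrami zonal_fun x = lam * zonal_fun x.
Proof.
move=> capx; have [cx x1] := capx.
have x0 : x != 0 by case: cx.
have Fx : Filter (nbhs (x : 'rV[R]_n.+1)) := nbhs_filter x.
rewrite (laplace_beltramiE zonal_fun_C2 capx) zonal_funE.
have q1 : q x = 1 by rewrite /q x1 invr1.
have D1 i : 'D_(e i) U x = U1 i x by have [_ ->] := dU i cx.
have D2 i : 'D_(e i) ('D_(e i) U) x = U2 i i x.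
  have -> : 'D_(e i) ('D_(e i) U) x = 'D_(e i) (U1 i) x.
    apply: near_eq_derive; apply: filterS (cone_near cx) => y cy.
    by have [_ ->] := dU i cy.
  by have [_ ->] := dU1 i i cx.
have sq1 : \sum_i x ord0 i ^+ 2 = 1 by rewrite -enorm_sqr x1 expr1n.
have so (F : 'I_n.+1 -> R) : \sum_i (i == o)%:R * F i = F o.
  rewrite (bigD1 o)//= eqxx mul1r big1 ?addr0// => i io.
  by rewrite (negPf io) mul0r.
have zE : z x = (1 - x ord0 o) / 2 by rewrite /z /tau q1 mulr1.
set t := x ord0 o in zE *.
have ode := hg_ode lam n0 ler01 (_ : 1 * 1 <= 1) (z_lt1 cx).
set F := hg n 1 lam (z x) in ode; set F1 := hg1 n 1 lam (z x) in ode.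
set F2 := hg2 n 1 lam (z x) in ode.
have E i : x ord0 i * 'D_(e i) U x + 'D_(e i) ('D_(e i) U) x =
   F2 / 4 * ((i == o)%:R * (1 - 2 * t * x ord0 i) + t ^+ 2 * x ord0 i ^+ 2)
   + F1 / 2 * ((i == o)%:R * (x ord0 i) + t - 2 * t * x ord0 i ^+ 2).
  rewrite D1 D2 /U1 /U2 /dtau /ddtau q1 -/F1 -/F2 -/t eqxx !expr1n.
  by case: (i == o); rewrite ?mulr1n ?mulr0n; field.
under eq_bigr do rewrite E.
rewrite big_split/= -!mulr_sumr sumrB !big_split/= -!mulr_sumr sq1 !so sumr_const card_ord.
rewrite /zonal_fun -/t -zE -/F.
have -> : lam * F = - (z x * (1 - 1 * z x) * F2 + n%:R / 2 * (1 - 2 * 1 * z x) * F1).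
  by apply/eqP; rewrite -addr_eq0 addrC ode.
by rewrite zE -mulr_natr -natr1; field.
Qed.

Lemma zonal_fun_continuous x : x ord0 ord_max > -1 -> `|x ord0 ord_max| <= 1 ->
  {for x, continuous zonal_fun}.
Proof.
move=> x1 xn; have Fx : Filter (nbhs (x : 'rV[R]_n.+1)) := nbhs_filter x.
apply: (@continuous_comp _ _ _ (fun y : 'rV[R]_n.+1 => (1 - y ord0 o) / 2) (hg n 1 lam)).
  apply: cvgMr_tmp; apply: cvgB; [exact: cvg_cst|exact: continuous_coord].
apply: is_derive_continuous; apply: (@is_derive_hg _ n 1 lam 1); rewrite ?mulr1//.
by move: xn => /ler_normlP[]; rewrite -/o in x1 *; move=> ? ?; rewrite ger0_norm; lra.
Qed.

End ZonalOnCone.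

(** * Eigenfunctions on the cap *)

Section Eigenfunctions.
Variable R : realType.

Lemma is_derive_line_at (V : normedModType R) (f : V -> R) (x v : V) (h a : R) :
  is_derive (h *: v + x) v f a -> is_derive h 1 (fun k : R => f (k *: v + x)) a.
Proof.
move=> /is_derive_line d.
rewrite (_ : (fun k => _) =
  (fun k : R => (fun l : R => f (l *: v + (h *: v + x))) (k - h))); last first.
  by apply/funext => k /=; rewrite addrA -scalerDl subrK.
rewrite -[a]mulr1; apply: (@is_derive_comp_fun _ _
  (fun l : R => f (l *: v + (h *: v + x))) (fun k : R => k - h)).
  by rewrite subrr.
have := is_deriveB_fun (is_derive_id h (1 : R)) (is_derive_cst h h (1 : R)).
by rewrite subr0.
Qed.

(** If [a > 0] then [f1] is positive just to the right of 0, where [f] would then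
    increase. *)
Lemma second_derivative_max (f f1 : R -> R) (a : R) :
  (\forall h \near (0 : R), is_derive h (1 : R) f (f1 h)) -> is_derive (0 : R) (1 : R) f1 a ->
  (\forall h \near (0 : R), f h <= f 0) -> f1 0 = 0 /\ a <= 0.
Proof.
move=> df df1 fmax.
have [r r0 hr] : exists2 r : R, 0 < r &
    forall h, `|h| < r -> is_derive h (1 : R) f (f1 h) /\ f h <= f 0.
  have : \forall h \near (0 : R), is_derive h (1 : R) f (f1 h) /\ f h <= f 0.
    by apply: filterS2 df fmax.
  move=> /nbhs_ballP[r r0 hr].
  by exists r => // h hh; apply: hr; rewrite /ball/= sub0r normrN.
have f10 : f1 0 = 0.
  have itv h : h \in `]-r, r[%R -> `|h| < r by rewrite in_itv/= ltr_norml.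
  have d0 : is_derive (0 : R) (1 : R) f 0.
    apply: (@derive1_at_max R f (- r) r 0).
    - by rewrite ge0_cp// ltW.
    - by move=> h /itv/hr[[]].
    - by rewrite in_itv/= oppr_lt0 r0.
    - by move=> h /itv/hr[].
  have [|[_ d0'] _] := hr 0; first by rewrite normr0.
  by rewrite -d0'; case: d0.
split=> //; rewrite leNgt; apply/negP => a0.
have [r' r'0 hr'] : exists2 r' : R, 0 < r' & forall h, 0 < h -> h < r' -> 0 < f1 h.
  have [d1 d1E] := df1.
  have /cvgr_gt/(_ 0 a0) : h^-1 *: (f1 (h *: 1 + 0) - f1 0) @[h --> 0^'] --> a.
    by rewrite -d1E.
  move=> /nbhs_ballP[r' r'0 hr']; exists r' => // h h0 hh.
  have := hr' h; rewrite /ball/= sub0r normrN gtr0_norm// => /(_ hh (lt0r_neq0 h0)).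
  by rewrite f10 subr0 addr0 [h%:A]mulr1 pmulr_rgt0 ?invr_gt0.
pose h := Num.min r r' / 2.
have m0 : 0 < Num.min r r' by rewrite lt_min r0.
have h0 : 0 < h by rewrite divr_gt0.
have hm : h < Num.min r r' by rewrite ltr_pdivrMr// ltr_pMr// ltr1n.
move: hm; rewrite lt_min => /andP[hr0 hr1].
have [|c /andP[c0 ch] E] := @mean_value R f f1 0 h h0.
  by move=> k /andP[k0 kh]; have [] := hr k; rewrite ?ger0_norm// (le_lt_trans kh).
have hh : `|h| < r by rewrite gtr0_norm.
have := (hr h hh).2.
rewrite -subr_le0 E subr0 leNgt => /negP; apply.
by rewrite mulr_gt0// hr'// (lt_trans ch).
Qed.

Section Cap.
Variables (n : nat) (gamma : R).
Hypotheses (g0 : 0 < gamma) (gpi : gamma < pi).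
Implicit Types (x y : 'rV[R]_n.+1).

Lemma capP x : enorm x = 1 -> cos gamma < x ord0 ord_max -> cap n gamma x.
Proof. by move=> x1 hx; split=> //; split; rewrite -?enorm_gt0 x1 ?mul1r. Qed.

Lemma closure_cap x : closure (cap n gamma) x ->
  enorm x = 1 /\ cos gamma <= x ord0 ord_max.
Proof.
pose S := (@enorm R n) @^-1` [set t | t = 1] `&`
  (fun x : 'rV[R]_n.+1 => x ord0 ord_max) @^-1` [set t | cos gamma <= t].
have cS : closed S.
  apply: closedI; apply: preimage_closed.
  - by move=> y _; exact: continuous_enorm.
  - exact: closed_eq.
  - by move=> y _; exact: continuous_coord.
  - exact: closed_ge.
move=> cx; have : closure S x.
  apply: closure_subset cx => y [[_ hy] y1]; split=> //=.
  by move: hy; rewrite y1 mul1r => /ltW.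
by move/closure_id: cS => <-.
Qed.

Lemma compact_closure_cap : compact (closure (cap n gamma)).
Proof.
apply: bounded_closed_compact; last exact: closed_closure.
exists 1; split=> // M M1 x /closure_cap[x1 _].
rewrite /= [leLHS]mx_normrE; apply: bigmax_le; first by rewrite ltW// (lt_trans ltr01).
move=> [i j] _ /=; rewrite (ord1 i).
by rewrite (le_trans (normr_coord_le _ _))// x1 ltW.
Qed.

Lemma pole_cap : cap n gamma (basis_vec R ord_max).
Proof.
have e1 : enorm (basis_vec R (ord_max : 'I_n.+1)) = 1.
  rewrite /enorm (bigD1 ord_max)//= big1 => [|i io]; last first.
    by rewrite !mxE/= (negPf io) expr0n.
  by rewrite !mxE/= !eqxx expr1n addr0 sqrtr1.
apply: capP => //; rewrite !mxE/= !eqxx.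
by rewrite -cos0 ltr_cos ?in_itv/= ?lexx ?pi_ge0// !ltW.
Qed.

Lemma colatitude x : enorm x = 1 -> cos gamma <= x ord0 ord_max ->
  exists2 t, 0 <= t <= gamma & cos t = x ord0 ord_max.
Proof.
move=> x1 hx; have := normr_coord_le x ord_max; rewrite x1 => /ler_normlP[xm xM].
have xI : -1 <= x ord0 ord_max <= 1 by rewrite lerNl xm.
exists (acos (x ord0 ord_max)); last by rewrite acosK// in_itv.
rewrite acos_ge0//= leNgt; apply/negP => h.
have := acos_lepi xI => hp; move: hx; rewrite leNgt => /negP; apply.
rewrite -[ltLHS]acosK ?in_itv//=.
by rewrite ltr_cos// in_itv/= ?(ltW g0) ?(ltW gpi)//= (le_trans (ltW g0) (ltW h)).
Qed.

End Cap.

Section ZonalEigenfunction.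
Variables (d : nat) (gamma : R).
Hypotheses (g0 : 0 < gamma) (gpi : gamma < pi).
Implicit Types (x y : 'rV[R]_d.+2) (lam : R).

Lemma zonal_funE lam x t : cos t = x ord0 ord_max ->
  zonal_fun lam x = zonal d lam t.
Proof. by rewrite /zonal_fun /zonal /zonal_coord => ->. Qed.

Lemma zonal_fun_continuous_closure lam x : closure (cap d.+1 gamma) x ->
  {for x, continuous (zonal_fun lam)}.
Proof.
move=> /closure_cap[x1 hx]; apply: zonal_fun_continuous => //.
  apply: lt_le_trans hx; rewrite -cospi.
  by rewrite ltr_cos ?in_itv/= ?lexx ?pi_ge0 ?(ltW g0) ?(ltW gpi).
by rewrite -x1 normr_coord_le.
Qed.

Lemma zonal_fun_dirichlet lam : zonal d lam gamma = 0 ->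
  (forall t, 0 <= t < gamma -> 0 < zonal d lam t) ->
  dirichlet_eigenfunction gamma lam (@zonal_fun R d.+1 lam).
Proof.
move=> zg zpos; split.
- exact: zonal_fun_C2.
- apply: continuous_in_subspaceT => x; rewrite inE.
  exact: zonal_fun_continuous_closure.
- move=> x [/closure_cap[x1 hx] Ncap].
  rewrite (@zonal_funE lam x gamma)//; apply/eqP; rewrite eq_le hx leNgt.
  by apply/negP => h; apply: Ncap; exact: capP.
- by move=> x; exact: zonal_fun_eigen.
- exists (basis_vec R ord_max); first exact: pole_cap.
  rewrite (@zonal_funE lam _ 0); first by rewrite zonal0 oner_neq0.
  by rewrite cos0 !mxE/= !eqxx.
Qed.

(** A positive solution for a larger parameter is a barrier: at a maximum of
    [|u| / w], with value [c], the function [s u - c w], where [s] is the sign of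
    [u] at that point, attains its maximum 0, yet its Laplacian is positive. As [u]
    vanishes on the boundary, the point is interior. *)
Lemma eigenvalue_ge_zonal lam mu (u : 'rV[R]_d.+2 -> R) :
  dirichlet_eigenfunction gamma lam u ->
  (forall t, 0 <= t <= gamma -> 0 < zonal d mu t) -> mu <= lam.
Proof.
move=> [uC2 uc ub ue [x1 capx1 ux1]] zpos; rewrite leNgt; apply/negP => lm.
pose w : 'rV[R]_d.+2 -> R := zonal_fun mu; pose K := closure (cap d.+1 gamma).
have wC2 : cap_C2 gamma w by exact: zonal_fun_C2.
have wpos x : K x -> 0 < w x.
  move=> /closure_cap[xn hx]; have [t tg ct] := colatitude g0 gpi xn hx.
  by rewrite /w (zonal_funE _ ct) zpos.
have wc x : K x -> {for x, continuous w} by exact: zonal_fun_continuous_closure.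
pose f x := `|u x| / w x.
have fc : {within K, continuous f}.
  move=> x; apply: cvgM; first by apply: cvg_norm; exact: uc.
  have : {within K, continuous (fun x => (w x)^-1)}.
    apply: continuous_in_subspaceT => y; rewrite inE => Ky.
    have Fy : Filter (nbhs (y : 'rV[R]_d.+2)) := nbhs_filter y.
    by apply: cvgV; [rewrite gt_eqF// wpos|exact: wc].
  exact.
have Kx1 : K x1 by exact: subset_closure.
have [x0 + fmax] := compact_EVT_max (ex_intro _ x1 Kx1) (@compact_closure_cap _ _) fc.
rewrite inE => Kx0; pose c := f x0; pose s := Num.sg (u x0).
have w0 := wpos x0 Kx0.
have c0 : 0 < c.
  apply: (@lt_le_trans _ _ (f x1)); last by apply: fmax; rewrite inE.
  by rewrite divr_gt0 ?normr_gt0 ?wpos.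
have u0 : u x0 != 0 by apply: contraTneq c0 => h; rewrite /c /f h normr0 mul0r ltxx.
have capx0 : cap d.+1 gamma x0.
  by apply: contrapT => N; move/eqP: u0; apply; apply: ub.
have cx0 := capx0.1; have x01 : enorm x0 = 1 := capx0.2.
have suE : s * u x0 = c * w x0.
  by rewrite /s -normrEsg /c /f divfK// gt_eqF.
pose U := u \o @sph_proj R d.+1; pose W := w \o @sph_proj R d.+1.
have Dle y : cone d.+1 gamma y -> s * U y - c * W y <= 0.
  move=> /cone_proj cy; rewrite subr_le0.
  have Ky : K (sph_proj y) by exact: subset_closure.
  apply: (@le_trans _ _ `|u (sph_proj y)|).
    rewrite (le_trans (ler_norm _))// normrM -[leRHS]mul1r ler_wpM2r//.
    by rewrite normr_sg lern1 leq_b1.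
  rewrite -ler_pdivrMr ?wpos//; apply: fmax; rewrite inE; exact: Ky.
have D0 : s * U x0 - c * W x0 = 0.
  by rewrite /U /W /= sph_proj_id// suE subrr.
pose e i : 'rV[R]_d.+2 := basis_vec R i.
have key i : s * 'D_(e i) U x0 - c * 'D_(e i) W x0 = 0 /\
    s * 'D_(e i) ('D_(e i) U) x0 - c * 'D_(e i) ('D_(e i) W) x0 <= 0.
  have line : \forall h \near (0 : R), cone d.+1 gamma (h *: e i + x0).
    have lc : h *: e i + x0 @[h --> (0 : R)] --> 0 *: e i + x0.
      by apply: cvgD; [apply: cvgZr_tmp; exact: cvg_id|exact: cvg_cst].
    apply: lc; rewrite scale0r add0r; exact: cone_near.
  have := @second_derivative_max
    (fun h => s * U (h *: e i + x0) - c * W (h *: e i + x0))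
    (fun h => s * 'D_(e i) U (h *: e i + x0) - c * 'D_(e i) W (h *: e i + x0))
    (s * 'D_(e i) ('D_(e i) U) x0 - c * 'D_(e i) ('D_(e i) W) x0).
  rewrite scale0r add0r; apply.
  - apply: filterS line => h ch.
    have [/derivableP dU _] := uC2.1 i _ ch; have [/derivableP dW _] := wC2.1 i _ ch.
    apply: is_deriveB_fun; apply: is_deriveMl_fun.
      exact: (is_derive_line_at dU).
    exact: (is_derive_line_at dW).
  - have [/derivableP /is_derive_line dU _] := uC2.2 i i _ cx0.
    have [/derivableP /is_derive_line dW _] := wC2.2 i i _ cx0.
    by apply: is_deriveB_fun; apply: is_deriveMl_fun.
  - by apply: filterS line => h ch; rewrite D0 Dle.
have lapu : laplace_beltrami u x0 = - (lam * u x0) by rewrite -ue// opprK.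
have lapw : laplace_beltrami w x0 = - (mu * w x0).
  by rewrite -(zonal_fun_eigen mu (ltn0Sn d) capx0) opprK.
have : s * laplace_beltrami u x0 - c * laplace_beltrami w x0 <= 0.
  rewrite (laplace_beltramiE uC2 capx0) (laplace_beltramiE wC2 capx0).
  rewrite !mulr_sumr -sumrB; apply: sumr_le0 => i _.
  have [k1 k2] := key i.
  have alg (p a b a2 b2 : R) : s * (p * a + a2) - c * (p * b + b2) =
    p * (s * a - c * b) + (s * a2 - c * b2) by ring.
  by rewrite alg k1 mulr0 add0r.
rewrite lapu lapw leNgt => /negP; apply.
have alg (a b : R) : s * - (lam * a) - c * - (mu * b) = mu * (c * b) - lam * (s * a).
  by ring.
rewrite alg suE -mulrBl.
by rewrite mulr_gt0 ?subr_gt0// mulr_gt0.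
Qed.

End ZonalEigenfunction.
End Eigenfunctions.

(** * The two bounds *)

Theorem theorem3p2 (R : realType) (n : nat) (hN : (3 <= n.+1)%N)
    (gamma : R) (hgamma0 : 0 < gamma) (hgammapi : gamma < pi)
    (lambda1 : R) (hlambda1 : first_dirichlet_eigenvalue n gamma lambda1)
    (B1 : R) (hB1 : first_positive_zero (besselJ ((n.+1%:R - 3) / 2)) B1) :
  (sin gamma / gamma) ^+ (n.+1 - 2) * (B1 / gamma) ^+ 2 <= lambda1 /\
  lambda1 <= (gamma / sin gamma) ^+ (n.+1 - 2) * (B1 / gamma) ^+ 2.
Proof.
case: n hN hlambda1 hB1 => [//|d] hd [[u u_eig] lambda1_min] hB1.
have d0 : (0 < d)%N by [].
have -> : (d.+2 - 2)%N = d by rewrite subSS subSS subn0.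
have nuE : (d.+2%:R - 3) / 2 = (d.+1%:R - 2) / 2 :> R.
  by rewrite -[d.+2%:R]natr1; congr (_ / 2); ring.
rewrite nuE in hB1; have [B0 BJ Bpos] := first_positive_zero_hg (d0 : (2 <= d.+1)%N) hB1.
split.
  apply/ler_addgt0Pl => eps eps0; rewrite -lerBlDl; set bound := _ * _.
  have bound0 : 0 < bound.
    by rewrite mulr_gt0// exprn_gt0// divr_gt0// sin_gt0_pi ?hgamma0.
  apply: (@le_trans _ _ (Num.max 0 (bound - eps))); first by rewrite le_max lexx orbT.
  apply: (eigenvalue_ge_zonal hgamma0 hgammapi u_eig).
  apply: (zonal_pos d0 hgamma0 hgammapi B0 Bpos); first by rewrite le_max lexx.
  by rewrite gt_max bound0 gtrBl.
apply/ler_addgt0Pl => eps eps0; rewrite addrC.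
set bound := _ * _.
have bound0 : 0 <= bound.
  by rewrite mulr_ge0 ?sqr_ge0// exprn_ge0// divr_ge0 ?ltW// sin_gt0_pi ?hgamma0.
have mu0 : 0 <= bound + eps by rewrite addr_ge0// ltW.
have vanish : ~ (forall t, 0 <= t <= gamma -> 0 < zonal d (bound + eps) t).
  by apply: (zonal_vanishes d0 hgamma0 hgammapi B0 BJ Bpos); rewrite ltrDl.
have [lam /andP[_ lam_le] [zg zpos]] := exists_zonal_first_zero d0 hgamma0 hgammapi mu0 vanish.
apply: le_trans lam_le; apply: lambda1_min; exists (@zonal_fun R d.+1 lam).
exact: zonal_fun_dirichlet.
Qed.
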